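(* Let $n\ge 1$, $d\ge n$, and let $\boldsymbol{\Sigma}\in\mathbb{R}^{d\times d}$ be positive definite with eigenvalue vector $\boldsymbol{\lambda}=(\lambda_1,\dots,\lambda_d)$, $\lambda_1\ge\dots\ge\lambda_d>0$. Let $\boldsymbol{\Phi}_{\mathsf{train}}\in\mathbb{R}^{n\times d}$ have i.i.d. rows $\boldsymbol{\phi}(X_i)^\top$ with $\boldsymbol{\phi}(X_i)\sim\mathcal{N}(\mathbf{0},\boldsymbol{\Sigma})$. For a label vector $\mathbf{Y}_{\mathsf{train}}=(Y_1,\dots,Y_n)\in\{\pm1\}^n$, let $\widehat{\boldsymbol{\alpha}}_{\mathsf{SVM}}$ be the hard-margin SVM solution $$\widehat{\boldsymbol{\alpha}}_{\mathsf{SVM}}=\arg\min_{\boldsymbol{\alpha}\in\mathbb{R}^d}\|\boldsymbol{\alpha}\|_2\quad\text{s.t.}\quad Y_i\,\boldsymbol{\phi}(X_i)^\top\boldsymbol{\alpha}\ge 1\ \text{ for all } i=1,\dots,n.$$ Then: 1. If $$\|\boldsymbol{\lambda}\|_1\ \ge\ 72\left(\|\boldsymbol{\lambda}\|_2\cdot n\sqrt{\ln n}+\|\boldsymbol{\lambda}\|_\infty\cdot n\sqrt{n}\,\ln n+1\right),$$ then with probability at least $1-\frac{2}{n}$ (over the features), simultaneously for every $\mathbf{Y}_{\mathsf{train}}\in\{\pm1\}^n$ the corresponding vector $\widehat{\boldsymbol{\alpha}}_{\mathsf{SVM}}$ satisfies $\boldsymbol{\Phi}_{\mathsf{train}}\widehat{\boldsymbol{\alpha}}_{\mathsf{SVM}}=\mathbf{Y}_{\mathsf{train}}$.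 2. If $\boldsymbol{\Sigma}=\mathbf{I}_d$ and $d>10\,n\ln n+n-1$, then for any fixed $\mathbf{Y}_{\mathsf{train}}\in\{\pm1\}^n$ (independent of the features), with probability at least $1-\frac{2}{n}$ the vector $\widehat{\boldsymbol{\alpha}}_{\mathsf{SVM}}$ satisfies $\boldsymbol{\Phi}_{\mathsf{train}}\widehat{\boldsymbol{\alpha}}_{\mathsf{SVM}}=\mathbf{Y}_{\mathsf{train}}$.
   Context: $\|\cdot\|_1,\|\cdot\|_2,\|\cdot\|_\infty$ are the usual vector norms applied to the eigenvalue vector $\boldsymbol{\lambda}$ of $\boldsymbol{\Sigma}$. *)

(* Defs.v *)
From HB Require Import structures.
From mathcomp Require Import all_boot all_order all_algebra.
From mathcomp Require Import all_classical all_reals all_analysis.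
From mathcomp Require Import normal_distribution.
Set Implicit Arguments. Unset Strict Implicit. Unset Printing Implicit Defensive.
Import Order.TTheory GRing.Theory Num.Theory.
Local Open Scope classical_set_scope.
Local Open Scope ring_scope.

(* Mutual independence of a finite family of real random variables:
   product rule for every choice of Borel sets (taking B i = setT gives the
   product rule for every subfamily). *)
Definition mutually_independent {R : realType} {d0 : measure_display}
  {T : measurableType d0} (P : probability T R) (I : finType) (X : I -> T -> R) :=
  (forall i, measurable_fun setT (X i)) /\
  forall B : I -> set R, (forall i, measurable (B i)) ->
    P (\bigcap_(i in [set: I]) (X i @^-1` B i)) = (\prod_(i : I) P (X i @^-1` B i))%E.

Definition std_normal {R : realType} {d0 : measure_display}
  {T : measurableType d0} (P : probability T R) (X : T -> R) :=
  forall B : set R, measurable B -> P (X @^-1` B) = normal_prob 0 1 B.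

(* Phi : T -> 'M_(n,d) has i.i.d. rows distributed as N(0, Sigma):
   Phi = Z A with Z an n x d matrix of i.i.d. N(0,1) entries and A^T A = Sigma
   (so each row z_i A is N(0, A^T A) and the rows are independent). *)
Definition iid_gaussian_rows {R : realType} {d0 : measure_display}
  {T : measurableType d0} (P : probability T R) (n d : nat)
  (Sigma : 'M[R]_d) (Phi : T -> 'M[R]_(n, d)) :=
  exists (Z : 'I_n * 'I_d -> T -> R) (A : 'M[R]_d),
    mutually_independent P Z /\ (forall ij, std_normal P (Z ij)) /\
    A^T *m A = Sigma /\
    forall w, Phi w = (\matrix_(i < n, j < d) Z (i, j) w) *m A.

Definition positive_definite {R : realType} (d : nat) (S : 'M[R]_d) :=
  S^T = S /\ forall x : 'rV[R]_d, x != 0 -> 0 < (x *m S *m x^T) 0 0.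

Definition eigenvalue_vector {R : realType} (d : nat) (S : 'M[R]_d) (lam : 'rV[R]_d) :=
  (exists U : 'M[R]_d, U^T *m U = 1%:M /\ S = U^T *m diag_mx lam *m U) /\
  (forall i j : 'I_d, (i <= j)%N -> lam 0 j <= lam 0 i).

Definition norm1 {R : realType} (d : nat) (v : 'rV[R]_d) := \sum_(j < d) `|v 0 j|.
Definition norm2 {R : realType} (d : nat) (v : 'rV[R]_d) :=
  Num.sqrt (\sum_(j < d) v 0 j ^+ 2).
Definition norminf {R : realType} (d : nat) (v : 'rV[R]_d) :=
  \big[Num.max/0]_(j < d) `|v 0 j|.
Definition vnorm2 {R : realType} (d : nat) (a : 'cV[R]_d) :=
  Num.sqrt (\sum_(j < d) a j 0 ^+ 2).

Definition pm1_vector {R : realType} (n : nat) (Y : 'cV[R]_n) :=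
  forall i, Y i 0 = 1 \/ Y i 0 = -1.

Definition svm_feasible {R : realType} (n d : nat) (Phi : 'M[R]_(n, d))
  (Y : 'cV[R]_n) (a : 'cV[R]_d) :=
  forall i, 1 <= Y i 0 * (Phi *m a) i 0.

Definition is_svm_solution {R : realType} (n d : nat) (Phi : 'M[R]_(n, d))
  (Y : 'cV[R]_n) (a : 'cV[R]_d) :=
  svm_feasible Phi Y a /\ forall b, svm_feasible Phi Y b -> vnorm2 a <= vnorm2 b.

Definition svm_interpolates {R : realType} (n d : nat) (Phi : 'M[R]_(n, d))
  (Y : 'cV[R]_n) :=
  (exists a, is_svm_solution Phi Y a) /\
  forall a, is_svm_solution Phi Y a -> Phi *m a = Y.

Definition holds_with_prob_ge {R : realType} {d0 : measure_display}
  {T : measurableType d0} (P : probability T R) (p : R) (Q : T -> Prop) :=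
  exists E : set T, measurable E /\ (p%:E <= P E)%E /\ forall w, E w -> Q w.

(* Main.v *)
(* The minimal-norm interpolator [Phi^T c], with [Phi Phi^T c = Y], is the SVM solution
   as soon as [Y_i c_i >= 0] for all [i], by Cauchy-Schwarz against any feasible vector.

   Part 1.  A rotation of the coordinates turns the Gram matrix into [X diag(lambda) X^T]
   with [X] standard Gaussian.  Chernoff bounds show that off a set of probability [2/n]
   every diagonal entry is at least [|lambda|_1 / 2] and every off-diagonal entry at most
   [|lambda|_1 / (4n)]; this dominance forces [Y_i c_i >= 0] for all labels at once.

   Part 2.  Rotating the samples so that [e_i] and the remaining labels become multiples
   of the first two axes, and then the coordinates so that samples 3, ..., n occupy the
   first n - 2 of them, [Y_i c_i < 0] implies [|q|^2 <= tau p.q], where [p, q] are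
   independent Gaussian vectors in dimension d - n + 2 and [tau^2 = n - 1].  A Chernoff
   bound makes this unlikely.

   Rotations are products of Givens rotations, for which invariance of the Gaussian law
   reduces to two affine substitutions and Tonelli; conditioning on some of the samples
   is replaced by reading them off an independent copy of the probability space. *)
Require Import Defs.
From HB Require Import structures.
From mathcomp Require Import all_boot all_order all_algebra.
From mathcomp Require Import all_classical all_reals all_analysis.
From mathcomp Require Import measurable_realfun normal_distribution ring lra.
Import Order.TTheory GRing.Theory Num.Theory.
Local Open Scope classical_set_scope.
Local Open Scope ring_scope.
Set Implicit Arguments.
Unset Strict Implicit.
Unset Printing Implicit Defensive.

(** The hypotheses give only one-dimensional marginals and a product rule. Accordingly no Gaussian
    density in more than two variables is ever formed: laws are compared on boxes, and every
    expectation is reduced, one coordinate at a time, to integrals on the line.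

    The labels enter the two parts differently. The bad events of part 1 speak of Gram entries only
    and so serve all labels at once: there are [2 n^2] of them, each of probability at most [n^-3],
    which makes [2 / n]. In part 2 the rotation of the samples is built from [Y] and [i], so the
    labels are fixed beforehand: there is one event of probability at most [n^-2] for each [i].

    The multipliers [c] require an invertible Gram matrix. In part 1 this follows from the
    dominance; in part 2 it holds off a null set, where a square minor of the sample matrix
    vanishes. *)

(** * Gaussian integrals on the line and rotations of the plane *)

(** The image of Lebesgue measure under [x -> a x + b], scaled by [a], agrees with Lebesgue measure
    on half-open intervals, hence on all measurable sets. *)
Lemma ge0_integral_affine (R : realType) (a b : R) (f : measurableTypeR R -> \bar R) :
  0 < a -> measurable_fun setT f -> (forall x, (0 <= f x)%E) ->
  (\int[lebesgue_measure]_x f (a * x + b)%R =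
   a^-1%:E * \int[lebesgue_measure]_x f x)%E.
Proof.
move=> a0 mf f0.
pose g (x : measurableTypeR R) : measurableTypeR R := a * x + b.
have mg : measurable_fun setT g.
  by apply: measurable_funD => //; exact: measurable_funM.
have ai0 : 0 <= a by exact: ltW.
have pushE (A : set (measurableTypeR R)) : measurable A ->
    lebesgue_measure A =
    mscale (NngNum ai0) (pushforward lebesgue_measure g) A.
  move=> mA; apply: (@lebesgue_measure_unique R
    (mscale (NngNum ai0) (pushforward lebesgue_measure g))) => // X [[p q]] _ <-.
  rewrite /mscale/= /pushforward.
  have gE : g @^-1` `]p, q]%classic = `](p - b) / a, (q - b) / a]%classic.
    apply/seteqP; split => x /=; rewrite !in_itv/= /g => /andP[h1 h2];
      apply/andP; split.
    - by rewrite ltr_pdivrMr// mulrC ltrBlDr.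
    - by rewrite ler_pdivlMr// mulrC lerBrDr.
    - by move: h1; rewrite ltr_pdivrMr// mulrC ltrBlDr.
    - by move: h2; rewrite ler_pdivlMr// mulrC lerBrDr.
  rewrite [X in _ = (_ * X)%E](_ : _ = lebesgue_measure `](p - b) / a, (q - b) / a]%classic); last by rewrite -gE.
  rewrite !lebesgue_measure_itv/= !lte_fin ltr_pM2r ?invr_gt0// ltrD2r.
  case: ifPn => _; last by rewrite mule0.
  rewrite -!EFinB -EFinM; congr EFin.
  by field; rewrite gt_eqF.
have ainv : (a^-1%:E * a%:E = 1)%E by rewrite -EFinM mulVf// gt_eqF.
transitivity (a^-1%:E * (a%:E *
    \int[lebesgue_measure]_(x in setT) (f \o g) x))%E; first by rewrite muleA ainv mul1e.
congr (_ * _)%E.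
rewrite -[in LHS](preimage_setT g) -(@ge0_integral_pushforward _ _ _ _ _ g mg) //.
rewrite (_ : a%:E = (NngNum ai0)%:num%:E)//.
rewrite -ge0_integral_mscale//.
apply: eq_measure_integral => A mA _; apply/esym; exact: pushE.
Qed.

(** The Radon-Nikodym derivative of the Gaussian law and [normal_pdf] have the same integral over
    every measurable set, so they agree almost everywhere. *)
Lemma integral_normal_prob (R : realType) (f : measurableTypeR R -> \bar R) :
  measurable_fun setT f -> (forall x, (0 <= f x)%E) ->
  (\int[normal_prob 0 1]_x f x =
   \int[lebesgue_measure]_x (f x * (normal_pdf 0 1 x)%:E))%E.
Proof.
move=> mf f0.
have mpdf : measurable_fun setT
    (fun x : measurableTypeR R => (normal_pdf 0 1 x)%:E : \bar R).
  by apply/measurable_EFinP; exact: measurable_normal_pdf.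
have pdf0 x : (0 <= (normal_pdf 0 1 x : R)%:E)%E by rewrite lee_fin normal_pdf_ge0.
have Nmu := @normal_prob_dominates R 0 1.
rewrite -(Radon_Nikodym_SigmaFinite.change_of_variables Nmu)//.
apply: ge0_ae_eq_integral => //.
- apply: emeasurable_funM => //.
  exact: measurable_int (Radon_Nikodym_SigmaFinite.f_integrable Nmu).
- exact: emeasurable_funM.
- by move=> x _; rewrite mule_ge0// Radon_Nikodym_SigmaFinite.f_ge0.
- by move=> x _; rewrite mule_ge0.
- apply: ae_eqe_mul2l; apply: integral_ae_eq => //.
    exact: Radon_Nikodym_SigmaFinite.f_integrable.
  by move=> E _ mE; rewrite -Radon_Nikodym_SigmaFinite.f_integral.
Qed.

Lemma std_normal_pdfE (R : realType) (x : R) :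
  normal_pdf 0 1 x = normal_peak 1 * expR (- x ^+ 2 / 2).
Proof. by rewrite normal_pdfE ?oner_eq0// /normal_fun subr0 expr1n. Qed.

(** Completing the square with [a^2 = 1 + t]: integrand times density is a constant times the
    density at [a x - s / a]. All the Chernoff bounds below rest on this formula. *)
Lemma integral_expR_normal_prob (R : realType) (s t : R) : 0 < 1 + t ->
  (\int[normal_prob 0 1]_(x in [set: measurableTypeR R])
     (expR (s * x - t * x ^+ 2 / 2))%:E =
   (expR (s ^+ 2 / (2 * (1 + t))) / Num.sqrt (1 + t))%:E)%E.
Proof.
move=> t0; set a := Num.sqrt (1 + t).
have a0 : 0 < a by rewrite sqrtr_gt0.
have a2 : a ^+ 2 = 1 + t by rewrite sqr_sqrtr// ltW.
have mpdf : measurable_fun setT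
    (fun x : measurableTypeR R => (normal_pdf 0 1 x)%:E : \bar R).
  by apply/measurable_EFinP; exact: measurable_normal_pdf.
rewrite integral_normal_prob//; last first.
  apply/measurable_EFinP; apply: measurableT_comp => //.
  apply: measurable_funB; first exact: measurable_funM.
  apply: measurable_funM => //; apply: measurable_funM => //.
transitivity (\int[lebesgue_measure]_(x in [set: measurableTypeR R])
   ((expR (s ^+ 2 / (2 * (1 + t))))%:E * (normal_pdf 0 1 (a * x + - s / a)%R)%:E))%E.
  apply: eq_integral => x _; rewrite -!EFinM; congr EFin.
  rewrite !std_normal_pdfE mulrCA [RHS]mulrCA; congr (_ * _).
  rewrite -!expRD; congr expR.
  rewrite sqrrD !exprMn a2 exprVn a2.
  have -> : a * x * (- s / a) = - (s * x) by field; rewrite gt_eqF.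
  by field; rewrite gt_eqF.
rewrite ge0_integralZl//; last 2 first.
- apply: (measurableT_comp mpdf).
  by apply: measurable_funD => //; exact: measurable_funM.
- by move=> x _; rewrite lee_fin normal_pdf_ge0.
rewrite (@ge0_integral_affine _ _ _
  (fun x : measurableTypeR R => (normal_pdf 0 1 x)%:E))//; last first.
  by move=> x; rewrite lee_fin normal_pdf_ge0.
by rewrite integral_normal_pdf mule1 -EFinM.
Qed.

(** At fixed [y] substitute [u = c x - s y]; exchange the integrals; at fixed [u] substitute
    [v = c^-1 y + (s / c) u]. The Jacobian factors [c^-1] and [c] cancel. Both substitutions are
    increasing because [0 < c]. *)
Lemma lebesgue_rotation (R : realType) (c s : R)
  (H : measurableTypeR R * measurableTypeR R -> \bar R) :
  0 < c -> c ^+ 2 + s ^+ 2 = 1 ->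
  measurable_fun setT H -> (forall z, (0 <= H z)%E) ->
  (\int[lebesgue_measure]_y \int[lebesgue_measure]_x
     H ((c * x - s * y)%R, (s * x + c * y)%R) =
   \int[lebesgue_measure]_x \int[lebesgue_measure]_y H (x, y))%E.
Proof.
move=> c0 cs mH H0.
have cn0 : c != 0 by rewrite gt_eqF.
have mK1 (y : R) : measurable_fun setT
    (fun u : measurableTypeR R => H (u, (s / c * u + c^-1 * y)%R)).
  apply: measurableT_comp => //; apply: measurable_fun_pair => //.
  by apply: measurable_funD => //; exact: measurable_funM.
have step1 (y : R) : (\int[lebesgue_measure]_x
    H ((c * x - s * y)%R, (s * x + c * y)%R) =
    c^-1%:E * \int[lebesgue_measure]_u H (u, (s / c * u + c^-1 * y)%R))%E.
  rewrite -(ge0_integral_affine (- (s * y)) c0)//; apply: eq_integral => x _.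
  congr (H (_, _)).
  have -> : s / c * (c * x - s * y) + c^-1 * y =
    s * x + (1 - s ^+ 2) / c * y by field.
  by rewrite -cs addrK; congr (_ + _ * _); field.
under eq_integral do rewrite step1.
rewrite ge0_integralZl//; last 3 first.
- apply: (measurable_fun_fubini_tonelli_F (fun z : measurableTypeR R * measurableTypeR R =>
      H (z.2, (s / c * z.2 + c^-1 * z.1)%R))) => //.
  apply: measurableT_comp => //; apply: measurable_fun_pair => //.
  by apply: measurable_funD => //; apply: measurable_funM.
- by move=> y _; exact: integral_ge0.
- by rewrite lee_fin invr_ge0 ltW.
rewrite (fubini_tonelli
    (fun z : measurableTypeR R * measurableTypeR R =>
      H (z.2, (s / c * z.2 + c^-1 * z.1)%R)))//=; last first.
  apply: measurableT_comp => //; apply: measurable_fun_pair => //.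
  by apply: measurable_funD => //; apply: measurable_funM.
rewrite -ge0_integralZl//; last 3 first.
- apply: (measurable_fun_fubini_tonelli_F (fun z : measurableTypeR R * measurableTypeR R =>
      H (z.1, (s / c * z.1 + c^-1 * z.2)%R))) => //.
  apply: measurableT_comp => //; apply: measurable_fun_pair => //.
  by apply: measurable_funD => //; apply: measurable_funM.
- by move=> y _; exact: integral_ge0.
- by rewrite lee_fin invr_ge0 ltW.
apply: eq_integral => u _.
have ci0 : 0 < c^-1 by rewrite invr_gt0.
under eq_integral do rewrite addrC.
rewrite (ge0_integral_affine (s / c * u) ci0 (f := fun v => H (u, v)))//; last first.
  by apply: measurableT_comp => //; exact: measurable_fun_pair.
by rewrite muleA -EFinM mulfV ?invr_eq0// mul1e.
Qed.

(** The product density depends only on [x^2 + y^2]. The iterated form of the left side is the one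
    that arises when the second of two coordinates is conditioned upon. *)
Lemma normal_prob_rotation (R : realType) (c s : R) (A B : set (measurableTypeR R)) :
  0 < c -> c ^+ 2 + s ^+ 2 = 1 -> measurable A -> measurable B ->
  (\int[normal_prob 0 1]_(y in [set: measurableTypeR R])
     normal_prob 0 1 [set x : measurableTypeR R |
        A (c * x - s * y)%R /\ B (s * x + c * y)%R] =
   normal_prob 0 1 A * normal_prob 0 1 B)%E.
Proof.
move=> c0 cs mA mB.
pose phi (x : measurableTypeR R) : \bar R := (normal_pdf 0 1 x)%:E.
have mphi : measurable_fun setT phi.
  by apply/measurable_EFinP; exact: measurable_normal_pdf.
have phi0 x : (0 <= phi x)%E by rewrite lee_fin normal_pdf_ge0.
pose gA (x : measurableTypeR R) : \bar R := ((\1_A x)%:E * phi x)%E.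
pose gB (x : measurableTypeR R) : \bar R := ((\1_B x)%:E * phi x)%E.
have mgA : measurable_fun setT gA.
  by apply: emeasurable_funM => //; exact/measurable_EFinP/measurable_indic.
have mgB : measurable_fun setT gB.
  by apply: emeasurable_funM => //; exact/measurable_EFinP/measurable_indic.
have i0 U (X : set U) x : (0 <= (\1_X x : R)%:E)%E by rewrite lee_fin indicE ler0n.
have gA0 x : (0 <= gA x)%E by apply: mule_ge0.
have gB0 x : (0 <= gB x)%E by apply: mule_ge0.
have NE (S : set (measurableTypeR R)) : measurable S ->
    (normal_prob 0 1 S = \int[lebesgue_measure]_x ((\1_S x)%:E * phi x))%E.
  move=> mS; rewrite -[in LHS](setIT S) -(integral_indic (normal_prob 0 1))//.
  rewrite integral_normal_prob//.
  - exact/measurable_EFinP/measurable_indic.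
pose S y := [set x : measurableTypeR R | A (c * x - s * y)%R /\ B (s * x + c * y)%R].
pose S2 : set (measurableTypeR R * measurableTypeR R) :=
   [set z | A (c * z.1 - s * z.2)%R /\ B (s * z.1 + c * z.2)%R].
have mS2 : measurable S2.
  apply: measurableI.
    rewrite -[X in measurable X]setTI.
    apply: (_ : measurable_fun setT (fun z : measurableTypeR R * measurableTypeR R =>
      (c * z.1 - s * z.2)%R : measurableTypeR R)) => //.
    by apply: measurable_funB; apply: measurable_funM.
  rewrite -[X in measurable X]setTI.
  apply: (_ : measurable_fun setT (fun z : measurableTypeR R * measurableTypeR R =>
      (s * z.1 + c * z.2)%R : measurableTypeR R)) => //.
  by apply: measurable_funD; apply: measurable_funM.
have mS y : measurable (S y).
  have -> : S y = ysection S2 y by rewrite ysectionE.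
  exact: measurable_ysection.
pose H (z : measurableTypeR R * measurableTypeR R) := (gA z.1 * gB z.2)%E.
have mH : measurable_fun setT H by apply: emeasurable_funM; apply: measurableT_comp.
have H0 z : (0 <= H z)%E by apply: mule_ge0.
have pp x y : (phi x * phi y =
   phi (c * x - s * y)%R * phi (s * x + c * y)%R)%E.
  rewrite /phi -!EFinM !std_normal_pdfE; congr EFin.
  rewrite mulrACA [RHS]mulrACA; congr (_ * _); rewrite -!expRD; congr expR.
  rewrite -!mulrDl -!opprD; congr (- _ / _).
  rewrite -[LHS]mul1r -cs; ring.
transitivity (\int[lebesgue_measure]_y \int[lebesgue_measure]_x
     H ((c * x - s * y)%R, (s * x + c * y)%R))%E; last first.
  rewrite lebesgue_rotation// [in RHS]NE// [in RHS]NE//.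
  rewrite -ge0_integralZr//.
  - apply: eq_integral => x _; rewrite -ge0_integralZl//.
    + by move=> y _; exact: gB0.
    + exact: gA0.
  - by move=> x _; exact: gA0.
  - by apply: integral_ge0 => x _; exact: gB0.
transitivity (\int[normal_prob 0 1]_y
   (\int[lebesgue_measure]_x ((\1_(S y) x)%:E * phi x)))%E.
  by apply: eq_integral => y _; rewrite -NE.
rewrite integral_normal_prob//; last 2 first.
- apply: (measurable_fun_fubini_tonelli_G (fun z : measurableTypeR R * measurableTypeR R =>
    ((\1_S2 z)%:E * phi z.1)%E)) => //.
  + apply: emeasurable_funM; first exact/measurable_EFinP/measurable_indic.
    exact: measurableT_comp.
  + by move=> z; apply: mule_ge0.
- by move=> y; apply: integral_ge0 => x _; apply: mule_ge0.
apply: eq_integral => y _.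
rewrite -ge0_integralZr//; last 3 first.
- by apply: emeasurable_funM => //; exact/measurable_EFinP/measurable_indic.
- by move=> x _; apply: mule_ge0.
- exact: phi0.
apply: eq_integral => x _.
rewrite -muleA pp /H/= /gA /gB muleACA; congr (_ * _)%E.
rewrite -EFinM !indicE -natrM mulnb; congr (_%:R%:E); congr nat_of_bool.
apply/idP/andP => [/set_mem[hA hB]|[/set_mem hA /set_mem hB]].
  by split; exact: mem_set.
by apply: mem_set; split.
Qed.

(** * Families of independent standard Gaussians: laws and conditioning *)

(** Generates the product sigma-algebra on [I -> R]. Since boxes are closed under intersection, two
    laws that agree on them are equal. *)
Definition boxes (R : realType) (I : finType) : set (set (I -> measurableTypeR R)) :=
  [set A | exists2 B : I -> set (measurableTypeR R),
     forall i, measurable (B i) & A = [set x | forall i, B i (x i)]].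

Notation sample R I := (g_sigma_algebraType (@boxes R I)).

(** Independence and the marginals in a single equation on boxes. [P] ranges over measures, so that
    the notion applies directly to a product [P \x P]. *)
Definition iidN (R : realType) (d : measure_display) (T : measurableType d)
    (P : {measure set T -> \bar R}) (I : finType) (X : I -> T -> measurableTypeR R) :=
  (forall i, measurable_fun setT (X i)) /\
  forall B : I -> set (measurableTypeR R), (forall i, measurable (B i)) ->
    P [set w | forall i, B i (X i w)] = (\prod_i normal_prob 0 1 (B i))%E.

Lemma measurable_coord (R : realType) (I : finType) (i : I) :
  measurable_fun setT (fun x : sample R I => x i : measurableTypeR R).
Proof.
move=> _ B mB; rewrite setTI; apply: sub_sigma_algebra.
exists (fun k => if k == i then B else setT) => [k|]; first by case: ifP.
apply/seteqP; split => x /= => [Bx k|/(_ i)]; last by rewrite eqxx.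
by case: eqP => [->|].
Qed.

Lemma measurable_sample (R : realType) (d : measure_display) (T : measurableType d)
    (I : finType) (X : I -> T -> measurableTypeR R) :
  (forall i, measurable_fun setT (X i)) ->
  measurable_fun setT (fun w => (fun i => X i w) : sample R I).
Proof.
move=> mX; apply: (@measurability _ _ T (sample R I) setT _ (@boxes R I)) => //.
move=> _ [_ [B mB ->] <-]; rewrite setTI.
rewrite (_ : _ @^-1` _ = \bigcap_(i in [set: I]) (X i @^-1` B i)); last first.
  by apply/seteqP; split => w /= h i; [move=> _; exact: h|exact: h].
apply: fin_bigcap_measurable; first exact: finite_finset.
by move=> i _; rewrite -[X in measurable X]setTI; exact: mX.
Qed.

Lemma setI_closed_boxes (R : realType) (I : finType) : setI_closed (@boxes R I).
Proof.
move=> _ _ [B mB ->] [C mC ->]; exists (fun i => B i `&` C i).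
  by move=> i; exact: measurableI.
apply/seteqP; split => x /=; first by move=> [hB hC] i; split.
by move=> h; split=> i; case: (h i).
Qed.

(** Uniqueness of a finite measure on a generating pi-system. The two families may live on different
    spaces, which is what allows passing to an independent copy. *)
Lemma iidN_law (R : realType) (d d' : measure_display) (T : measurableType d)
    (T' : measurableType d') (P : {measure set T -> \bar R})
    (P' : {measure set T' -> \bar R}) (I : finType)
    (X : I -> T -> measurableTypeR R) (X' : I -> T' -> measurableTypeR R)
    (h : sample R I -> \bar R) :
  iidN P X -> iidN P' X' -> measurable_fun setT h -> (forall x, (0 <= h x)%E) ->
  (\int[P]_w h (fun i => X i w) = \int[P']_w h (fun i => X' i w))%E.
Proof.
move=> [mX PX] [mX' PX'] mh h0.
have mS := measurable_sample mX; have mS' := measurable_sample mX'.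
rewrite -[LHS](@ge0_integral_pushforward _ _ _ _ _ _ mS P setT h)//.
rewrite -[RHS](@ge0_integral_pushforward _ _ _ _ _ _ mS' P' setT h)//.
apply: eq_measure_integral => A mA _.
have bT : @boxes R I setT.
  by exists (fun=> setT) => //; apply/seteqP; split.
apply: (@measure_unique _ R (sample R I) (@boxes R I) (fun=> setT)) => //.
- exact: setI_closed_boxes.
- by rewrite bigcup_const.
- by move=> _ [B mB ->]; exact: (etrans (PX B mB) (esym (PX' B mB))).
- move=> k; apply: (@le_lt_trans _ _ 1%E); last exact: ltry.
  rewrite le_eqVlt; apply/orP; left; apply/eqP.
  transitivity (\prod_(i : I) normal_prob (0 : R) 1 setT)%E.
    rewrite -(PX (fun=> setT))//; congr (P _).
    by apply/seteqP; split.
  by apply: big1 => i _; exact: probability_setT.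
Qed.

(** The event that the mixed family lies in a box is a rectangle in [T * T]: each factor constrains
    the coordinates read off its own copy. *)
Lemma iidN_mix (R : realType) (d : measure_display) (T : measurableType d)
    (P : probability T R) (I : finType) (X : I -> T -> measurableTypeR R) (A : pred I) :
  iidN P X ->
  iidN (P \x P)%E (fun i (z : T * T) => if A i then X i z.2 else X i z.1).
Proof.
move=> [mX PX]; split=> [i|B mB].
  case: (A i); first exact: (measurableT_comp (mX i) measurable_snd).
  exact: (measurableT_comp (mX i) measurable_fst).
pose C (b : bool) i := if A i == b then B i else setT.
have mC b i : measurable (C b i) by rewrite /C; case: ifP.
have mbox b : measurable [set w | forall i, C b i (X i w)].
  have /(_ measurableT [set x | forall i, C b i (x i)]) := measurable_sample mX.
  rewrite setTI; apply; apply: sub_sigma_algebra; by exists (C b).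
rewrite (_ : [set w | _] =
    [set w | forall i, C false i (X i w)] `*` [set w | forall i, C true i (X i w)]).
  apply: (etrans (product_measure1E _ _ _ _)) => //.
  rewrite !PX// -big_split/=; apply: eq_bigr => i _.
  by rewrite /C; case: (A i) => /=; rewrite probability_setT ?mul1e ?mule1.
apply/seteqP; split => -[w' w] /=.
  by move=> h; split=> i; have := h i; rewrite /C; case: (A i).
move=> [h1 h2] i; have := h1 i; have := h2 i; rewrite /C; by case: (A i).
Qed.

(* Conditioning on the coordinates outside [A]: they are read off an independent
   copy [w'] of the sample point. *)
Lemma iidN_freeze (R : realType) (d : measure_display) (T : measurableType d)
    (P : probability T R) (I : finType) (X : I -> T -> measurableTypeR R) (A : pred I)
    (h : sample R I -> \bar R) :
  iidN P X -> measurable_fun setT h -> (forall x, (0 <= h x)%E) ->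
  (\int[P]_w h (fun i => X i w) =
   \int[P]_w' \int[P]_w h (fun i => if A i then X i w else X i w'))%E.
Proof.
move=> iX mh h0; have iM := iidN_mix A iX.
rewrite (iidN_law iX iM mh h0) fubini_tonelli1//.
apply: (measurableT_comp mh); apply: measurable_sample; exact: iM.1.
Qed.

Lemma iidN_coord (R : realType) (d : measure_display) (T : measurableType d)
    (P : probability T R) (I : finType) (X : I -> T -> measurableTypeR R) (i : I)
    (B : set (measurableTypeR R)) :
  iidN P X -> measurable B -> P (X i @^-1` B) = normal_prob 0 1 B.
Proof.
move=> [_ PX] mB.
rewrite (_ : _ @^-1` _ = [set w | forall k, (if k == i then B else setT) (X k w)]).
  apply: etrans (PX (fun k => if k == i then B else setT) _) _.
    by move=> k; case: ifP.
  rewrite (bigD1 i)//= eqxx big1 ?mule1// => k /negbTE ->.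
  exact: probability_setT.
apply/seteqP; split => w /=; last by move=> /(_ i); rewrite eqxx.
by move=> h k; case: eqP => [->|].
Qed.

Lemma iidN_integral_coord (R : realType) (d : measure_display) (T : measurableType d)
    (P : probability T R) (I : finType) (X : I -> T -> measurableTypeR R) (i : I)
    (f : measurableTypeR R -> \bar R) :
  iidN P X -> measurable_fun setT f -> (forall x, (0 <= f x)%E) ->
  (\int[P]_w f (X i w) = \int[normal_prob 0 1]_x f x)%E.
Proof.
move=> iX mf f0; have mX := iX.1 i.
rewrite -[LHS](@ge0_integral_pushforward _ _ _ _ _ _ mX P setT f)//.
by apply: eq_measure_integral => A mA _; exact: iidN_coord.
Qed.

Lemma measurable_eprod_coord (R : realType) (I : finType)
    (f : I -> measurableTypeR R -> \bar R) (s : seq I) :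
  (forall i, measurable_fun setT (f i)) ->
  measurable_fun setT (fun x : sample R I => \prod_(i <- s) f i (x i))%E.
Proof.
move=> mf; elim: s => [|i s IH].
  by apply: (eq_measurable_fun (fun=> 1%E)) => [x _|//]; rewrite big_nil.
apply: (eq_measurable_fun (fun x : sample R I =>
  f i (x i) * \prod_(i <- s) f i (x i))%E) => [x _|]; first by rewrite big_cons.
apply: emeasurable_funM => //.
exact: (measurableT_comp (mf i) (@measurable_coord R I i)).
Qed.

(** Induction on a duplicate-free list of indices: with every coordinate but [i] frozen, the
    remaining factors are constants of the inner integral. *)
Lemma iidN_integral_prod (R : realType) (d : measure_display) (T : measurableType d)
    (P : probability T R) (I : finType) (X : I -> T -> measurableTypeR R)
    (f : I -> measurableTypeR R -> \bar R) :
  iidN P X -> (forall i, measurable_fun setT (f i)) -> (forall i x, (0 <= f i x)%E) ->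
  (\int[P]_w \prod_i f i (X i w) = \prod_i \int[normal_prob 0 1]_x f i x)%E.
Proof.
move=> iX mf f0.
have prod0 (s : seq I) (x : I -> R) : (0 <= \prod_(i <- s) f i (x i))%E.
  by elim: s => [|i s IH]; rewrite ?big_nil ?big_cons ?mule_ge0// ?lee01.
suff: forall s : seq I, uniq s ->
  (\int[P]_w \prod_(i <- s) f i (X i w) =
   \prod_(i <- s) \int[normal_prob 0 1]_x f i x)%E.
  by apply; exact: index_enum_uniq.
elim=> [_|i s IH /= /andP[si us]].
  under eq_integral do rewrite big_nil.
  by rewrite big_nil integral_cst// mul1e; exact: probability_setT.
rewrite big_cons -(IH us) -(iidN_integral_coord i iX (mf i) (f0 i)).
rewrite (@iidN_freeze _ _ _ _ _ _ (pred1 i)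
  (fun x => \prod_(k <- i :: s) f k (x k))%E iX)//; last exact: measurable_eprod_coord.
rewrite muleC -ge0_integralZr//; last 2 first.
- apply: (measurableT_comp (measurable_eprod_coord s mf)).
  exact: measurable_sample iX.1.
- by apply: integral_ge0 => w _; exact: f0.
apply: eq_integral => w' _.
rewrite -ge0_integralZl//; last first.
  exact: (measurableT_comp (mf i) (iX.1 i)).
apply: eq_integral => w _; rewrite big_cons /= eqxx muleC; congr (_ * _)%E.
apply: eq_big_seq => k ks /=; case: eqP => // ki.
by move: si; rewrite -ki ks.
Qed.

(** * Givens rotations: invariance of the Gaussian law and triangularisation *)

(** With all coordinates but [i] frozen, the inner probability is that of a section of the planar
    event [S2] at the [j]th coordinate, provided the other coordinates lie in their boxes. This is a
    product of functions of single coordinates, and its factor at [j] integrates to the planar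
    statement. *)
Lemma iidN_givens (R : realType) (d : measure_display) (T : measurableType d)
    (P : probability T R) (I : finType) (X : I -> T -> measurableTypeR R)
    (i j : I) (c s : R) :
  i != j -> 0 < c -> c ^+ 2 + s ^+ 2 = 1 -> iidN P X ->
  iidN P (fun k w => if k == i then c * X i w - s * X j w
                     else if k == j then s * X i w + c * X j w else X k w).
Proof.
move=> ij c0 cs iX; have mX := iX.1.
have ji : (j == i) = false by rewrite eq_sym (negbTE ij).
have mX' k : measurable_fun setT (fun w => (if k == i then c * X i w - s * X j w
    else if k == j then s * X i w + c * X j w else X k w) : measurableTypeR R).
  case: (k == i).
    by apply: measurable_funB; apply: measurable_funM => //; exact: mX.
  case: (k == j); last exact: mX.
  by apply: measurable_funD; apply: measurable_funM => //; exact: mX.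
split=> // B mB.
pose N : set (measurableTypeR R) -> \bar R := normal_prob 0 1.
pose S : set (sample R I) := [set x | forall k,
  B k (if k == i then c * x i - s * x j
       else if k == j then s * x i + c * x j else x k)].
have mS : measurable S.
  have mp k : measurable_fun setT (fun x : sample R I => (if k == i then c * x i - s * x j
      else if k == j then s * x i + c * x j else x k) : measurableTypeR R).
    have mc l := @measurable_coord R I l.
    case: (k == i).
      by apply: measurable_funB; apply: measurable_funM => //; exact: mc.
    case: (k == j); last exact: mc.
    by apply: measurable_funD; apply: measurable_funM => //; exact: mc.
  rewrite (_ : S = \bigcap_(k in [set: I]) ((fun x : sample R I => (if k == i then c * x i - s * x j
      else if k == j then s * x i + c * x j else x k) : measurableTypeR R) @^-1` B k)).
    apply: fin_bigcap_measurable; first exact: finite_finset.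
    by move=> k _; rewrite -[X in measurable X]setTI; exact: mp.
  by apply/seteqP; split => x /= h k; [move=> _; exact: h|exact: h].
pose hS (x : sample R I) : \bar R := (\1_S x)%:E.
have mhS : measurable_fun setT hS by exact/measurable_EFinP/measurable_indic.
have mXS : measurable [set w | S (fun k => X k w)].
  have := measurable_sample mX; move=> /(_ measurableT S mS); rewrite setTI; exact.
transitivity (\int[P]_w hS (fun k => X k w))%E.
  rewrite (_ : [set w | _] = [set w | S (fun k => X k w)])//.
  by rewrite -[in LHS](setIT [set w | _]) -(integral_indic P)//.
rewrite (iidN_freeze (pred1 i) iX mhS); last first.
  by move=> x; rewrite lee_fin indicE ler0n.
pose S2 : set (measurableTypeR R * measurableTypeR R) :=
   [set z | B i (c * z.1 - s * z.2) /\ B j (s * z.1 + c * z.2)].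
have mS2 : measurable S2.
  apply: measurableI.
    rewrite -[X in measurable X]setTI.
    apply: (_ : measurable_fun setT (fun z : measurableTypeR R * measurableTypeR R =>
      (c * z.1 - s * z.2)%R : measurableTypeR R)) => //.
    by apply: measurable_funB; apply: measurable_funM.
  rewrite -[X in measurable X]setTI.
  apply: (_ : measurable_fun setT (fun z : measurableTypeR R * measurableTypeR R =>
      (s * z.1 + c * z.2)%R : measurableTypeR R)) => //.
  by apply: measurable_funD; apply: measurable_funM.
(* The factor of coordinate [k] once [i] is integrated out; [i] itself leaves the factor 1. *)
pose g k (y : measurableTypeR R) : \bar R :=
  if k == i then 1%E else if k == j then N (ysection S2 y) else (\1_(B k) y)%:E.
have mg k : measurable_fun setT (g k).
  rewrite /g; case: (k == i) => //; case: (k == j).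
    exact: measurable_fun_ysection.
  exact/measurable_EFinP/measurable_indic.
have g0 k y : (0 <= g k y)%E.
  rewrite /g; case: (k == i); first exact: lee01.
  case: (k == j); first exact: measure_ge0.
  by rewrite lee_fin indicE ler0n.
transitivity (\int[P]_w' \prod_k g k (X k w'))%E; last first.
  rewrite iidN_integral_prod// (bigD1 i)//= (bigD1 j)/=; last by rewrite eq_sym.
  rewrite [RHS](bigD1 i)//= [in RHS](bigD1 j)/=; last by rewrite eq_sym.
  rewrite !muleA; congr (_ * _)%E.
    rewrite /g eqxx ji eqxx integral_cst// mul1e.
    rewrite -(normal_prob_rotation c0 cs)//.
    rewrite [X in (X * _)%E](_ : _ = 1%E) ?mul1e; last exact: probability_setT.
    by apply: eq_integral => y _; rewrite ysectionE.
  apply: eq_bigr => k /andP[/negbTE ki /negbTE kj]; rewrite /g ki kj.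
  by rewrite integral_indic ?setIT.
apply: eq_integral => w' _.
rewrite (bigD1 i)//= (bigD1 j)/=; last by rewrite eq_sym.
rewrite {1 2}/g eqxx ji eqxx mul1e.
(* If some other frozen coordinate misses its box, both sides vanish. *)
have [allB|] := pselect (forall k, k != i -> k != j -> B k (X k w')).
  rewrite big1 ?mule1; last first.
    move=> k /andP[ki kj]; rewrite /g (negbTE ki) (negbTE kj) indicE.
    by rewrite mem_set//; exact: allB.
  transitivity (P (X i @^-1` ysection S2 (X j w'))); last first.
    by apply: iidN_coord => //; exact: measurable_ysection.
  rewrite -[in RHS](setIT (_ @^-1` _)) -(integral_indic P)//; last first.
    rewrite -[X in measurable X]setTI; apply: mX => //; exact: measurable_ysection.
  apply: eq_integral => w _; rewrite /hS !indicE; congr (_%:R%:E).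
  congr nat_of_bool; apply/idP/idP => /set_mem h; apply: mem_set; move: h.
    rewrite ysectionE /= => h; split.
      by have := h i; rewrite /= !eqxx ji.
    by have := h j; rewrite /= !eqxx ji.
  rewrite ysectionE /= => -[h1 h2] k /=; rewrite eqxx ji.
  case: eqP => [->//|/eqP ki]; case: eqP => [->//|/eqP kj].
  exact: allB.
move=> /existsNP[k /not_implyP[ki /not_implyP[kj nB]]].
rewrite (bigD1 k) ?ki//= {1}/g (negbTE ki) (negbTE kj) indicE memNset// mul0e mule0.
rewrite integral0_eq// => w _; rewrite /hS indicE memNset// => /(_ k) /=.
by rewrite (negbTE ki) (negbTE kj).
Qed.

Definition givens (R : realType) (d : nat) (i j : 'I_d) (c s : R) : 'M[R]_d :=
  \matrix_(k, l) (if l == i then (if k == i then c else if k == j then - s else 0)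
                  else if l == j then (if k == i then s else if k == j then c else 0)
                  else (k == l)%:R).

Lemma mulmx_givens (R : realType) (r d : nat) (i j : 'I_d) (c s : R) (V : 'M[R]_(r, d))
    (a : 'I_r) (l : 'I_d) : i != j ->
  (V *m givens i j c s) a l = if l == i then c * V a i - s * V a j
     else if l == j then s * V a i + c * V a j else V a l.
Proof.
move=> ij; have ji : (j == i) = false by rewrite eq_sym (negbTE ij).
have two (x y : R) :
    \sum_k V a k * (if k == i then x else if k == j then y else 0) = x * V a i + y * V a j.
  rewrite (bigD1 i)//= (bigD1 j)/=; last by rewrite eq_sym.
  rewrite eqxx ji eqxx big1 ?addr0; first by rewrite mulrC [V a j * _]mulrC.
  by move=> k /andP[/negbTE -> /negbTE ->]; rewrite mulr0.
rewrite !mxE; case: (eqVneq l i) => [li|li].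
  rewrite -mulNr -two; apply: eq_bigr => k _; rewrite !mxE li eqxx//.
case: (eqVneq l j) => [lj|lj].
  by rewrite -two; apply: eq_bigr => k _; rewrite !mxE lj ji eqxx.
rewrite (bigD1 l)//= mxE (negbTE li) (negbTE lj) eqxx mulr1 big1 ?addr0// => k kl.
by rewrite mxE (negbTE li) (negbTE lj) (negbTE kl) mulr0.
Qed.

Lemma givens_orthogonal (R : realType) (d : nat) (i j : 'I_d) (c s : R) :
  i != j -> c ^+ 2 + s ^+ 2 = 1 -> (givens i j c s)^T *m givens i j c s = 1%:M.
Proof.
move=> ij cs; have ji : (j == i) = false by rewrite eq_sym (negbTE ij).
apply/matrixP => a l; rewrite mulmx_givens// !mxE ?eqxx ?ji.
have [li|li] := eqVneq l i.
  rewrite li; have [ai|ai] := eqVneq a i; first by rewrite /= mulr1n -cs; ring.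
  by have [aj|aj] := eqVneq a j; rewrite /= ?mulr0n; ring.
have [lj|lj] := eqVneq l j.
  rewrite lj; have [ai|ai] := eqVneq a i.
    by rewrite ai (negbTE ij) /= ?mulr0n; ring.
  have [aj|aj] := eqVneq a j; first by rewrite /= mulr1n -cs; ring.
  by rewrite /= ?mulr0n; ring.
have [ai|ai] := eqVneq a i; first by rewrite ai eq_sym (negbTE li).
have [aj|aj] := eqVneq a j; first by rewrite aj eq_sym (negbTE lj).
by rewrite eq_sym.
Qed.

(* Products of Givens rotations of angle less than a right angle: enough of the
   orthogonal group for triangularisation, and for each generator the change of
   variables is a pair of affine substitutions. *)
Inductive rotation (R : realType) (d : nat) : 'M[R]_d -> Prop :=
| rotation1 : rotation 1%:M
| rotation_givens U i j c s : rotation U -> i != j -> 0 < c ->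
    c ^+ 2 + s ^+ 2 = 1 -> rotation (U *m givens i j c s).

Lemma rotationM (R : realType) (d : nat) (U V : 'M[R]_d) :
  rotation U -> rotation V -> rotation (U *m V).
Proof.
move=> rU; elim=> [|V' i j c s rV IH ij c0 cs]; first by rewrite mulmx1.
by rewrite mulmxA; exact: rotation_givens.
Qed.

Lemma rotation_orthogonal (R : realType) (d : nat) (U : 'M[R]_d) :
  rotation U -> U^T *m U = 1%:M.
Proof.
elim=> [|V i j c s rV IH ij c0 cs]; first by rewrite trmx1 mulmx1.
by rewrite trmx_mul -mulmxA (mulmxA V^T) IH mul1mx givens_orthogonal.
Qed.

Lemma iidN_rotation (R : realType) (d0 : measure_display) (T : measurableType d0)
    (P : probability T R) (J : finType) (d : nat)
    (X : J * 'I_d -> T -> measurableTypeR R) (U : 'M[R]_d) :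
  rotation U -> iidN P X ->
  iidN P (fun jk w => \sum_l X (jk.1, l) w * U l jk.2).
Proof.
move=> rU; elim: rU X => [|V i j c s rV IH ij c0 cs] X iX.
  rewrite (_ : (fun _ _ => _) = X)//; apply/funext => -[a k]; apply/funext => w.
  rewrite (bigD1 k)//= mxE eqxx mulr1 big1 ?addr0// => l lk.
  by rewrite mxE (negbTE lk) mulr0.
have ji : (j == i) = false by rewrite eq_sym (negbTE ij).
pose Y (jk : J * 'I_d) w := \sum_l X (jk.1, l) w * V l jk.2.
(* The planar lemma moves one pair of coordinates, whereas the new factor acts on every row: [Z t]
   has it applied to the rows in [t] only. *)
pose Z (t : seq J) (jk : J * 'I_d) (w : T) : measurableTypeR R :=
  if jk.1 \in t then
    if jk.2 == i then c * Y (jk.1, i) w - s * Y (jk.1, j) w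
    else if jk.2 == j then s * Y (jk.1, i) w + c * Y (jk.1, j) w else Y jk w
  else Y jk w.
suff iZ t : uniq t -> iidN P (Z t).
  rewrite (_ : (fun _ _ => _) = Z (enum J)); first exact/iZ/enum_uniq.
  apply/funext => -[a k]; apply/funext => w; rewrite /Z/= mem_enum inE.
  pose v : 'rV[R]_d := \row_l X (a, l) w.
  transitivity ((v *m (V *m givens i j c s)) 0 k).
    by rewrite mxE; apply: eq_bigr => l _; rewrite !mxE.
  have YE l : Y (a, l) w = (v *m V) 0 l.
    by rewrite mxE; apply: eq_bigr => m _; rewrite mxE.
  by rewrite mulmxA mulmx_givens// !YE.
elim: t => [_|a t IHt /= /andP[at_ ut]]; first exact: IH.
have aij : (a, i) != (a, j) by rewrite xpair_eqE eqxx.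
have := iidN_givens aij c0 cs (IHt ut); congr (iidN P _).
apply/funext => -[b k]; apply/funext => w; rewrite /Z/= inE !xpair_eqE (negbTE at_).
by have [->|ba] := eqVneq b a; rewrite //= ?(negbTE at_).
Qed.

(** The cosine is [|a| / r], with the sign of [a] moved into the sine. For [a = 0] and [b != 0] a
    right angle would be forced, against [0 < c]. *)
Lemma givens_angle (R : realType) (a b : R) : a != 0 ->
  exists c s : R, [/\ 0 < c, c ^+ 2 + s ^+ 2 = 1 & s * a + c * b = 0].
Proof.
move=> a0; pose r := Num.sqrt (a ^+ 2 + b ^+ 2).
have ab0 : 0 < a ^+ 2 + b ^+ 2 by rewrite ltr_pwDl ?sqr_ge0// exprn_even_gt0.
have r0 : 0 < r by rewrite sqrtr_gt0.
have r2 : r ^+ 2 = a ^+ 2 + b ^+ 2 by rewrite sqr_sqrtr// ltW.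
exists (`|a| / r), (- Num.sg a * b / r); split.
- by rewrite divr_gt0// normr_gt0.
- rewrite !exprMn exprVn r2 sqrrN sqr_sg a0 mul1r real_normK ?num_real//.
  by rewrite -mulrDl divff// gt_eqF.
- have -> : - Num.sg a * b / r * a = - (Num.sg a * a) * b / r by ring.
  by rewrite -normrEsg; ring.
Qed.

(** The last clause protects zeros: a row that vanishes in both columns still does so afterwards. *)
Lemma rotation_eliminate (R : realType) (r d : nat) (V : 'M[R]_(r, d)) (k : 'I_r)
    (i j : 'I_d) : i != j ->
  exists U, [/\ rotation U, (V *m U) k j = 0,
    forall a l, l != i -> l != j -> (V *m U) a l = V a l &
    forall a, V a i = 0 -> V a j = 0 -> (V *m U) a i = 0 /\ (V *m U) a j = 0].
Proof.
move=> ij; have ji : (j == i) = false by rewrite eq_sym (negbTE ij).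
wlog ki0 : V / V k i != 0 \/ V k j = 0 => [wl|].
  have [kj0|kj0] := eqVneq (V k j) 0; first by apply: wl; right.
  have [ki0|ki0] := eqVneq (V k i) 0; last by apply: wl; left.
  (* A zero pivot would call for a right angle. A preliminary turn by any other angle with nonzero
     sine makes the pivot nonzero, here [- 4 / 5 * V k j]; the Pythagorean triple 3, 4, 5 keeps it
     rational. *)
  pose G := givens i j (3 / 5 : R) (4 / 5).
  have cs : (3 / 5) ^+ 2 + (4 / 5) ^+ 2 = 1 :> R by field.
  have c0 : (0 : R) < 3 / 5 by lra.
  have [|U [rU h1 h2 h3]] := wl (V *m G).
    left; rewrite mulmx_givens// eqxx ki0 mulr0 sub0r oppr_eq0 mulf_neq0//.
  exists (G *m U); split; rewrite ?mulmxA//.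
  - by apply: rotationM => //; rewrite -[G]mul1mx; exact: rotation_givens (rotation1 _ _) _ _ _.
  - by move=> a l li lj; rewrite h2// mulmx_givens// (negbTE li) (negbTE lj).
  - by move=> a ai aj; apply: h3; rewrite mulmx_givens// ?eqxx ?ji ai aj; ring.
have [kj0|kj0] := eqVneq (V k j) 0.
  by exists 1%:M; split=> *; rewrite ?mulmx1//; exact: rotation1.
case: ki0 => [ki0|]; last by move/eqP; rewrite (negbTE kj0).
have [c [s [c0 cs e]]] := givens_angle (V k j) ki0.
exists (givens i j c s); split.
- by rewrite -[givens _ _ _ _]mul1mx; exact: rotation_givens (rotation1 _ _) _ _ _.
- by rewrite mulmx_givens// ji eqxx.
- by move=> a l li lj; rewrite mulmx_givens// (negbTE li) (negbTE lj).
- by move=> a ai aj; rewrite !mulmx_givens// !eqxx ji ai aj; split; ring.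
Qed.

(** Entry [(k, m)] with [k < m] is cleared against column [k]. Rows above [k] already vanish in both
    columns, so their zeros survive, and so do those of row [k] in the columns strictly between [k]
    and [m], which are untouched. *)
Lemma rotation_lower (R : realType) (r d : nat) (V : 'M[R]_(r, d)) :
  exists2 U, rotation U & forall (a : 'I_r) (l : 'I_d), (a < l)%N -> (V *m U) a l = 0.
Proof.
suff: forall k, exists2 U, rotation U &
    forall (a : 'I_r) (l : 'I_d), (a < k)%N -> (a < l)%N -> (V *m U) a l = 0.
  by move=> /(_ r)[U rU h]; exists U => // a l; exact: h.
elim=> [|k [U rU IH]]; first by exists 1%:M => //; exact: rotation1.
have [kr|rk] := ltnP k r; last first.
  by exists U => // a l _; apply: IH; exact: leq_trans (ltn_ord a) rk.
have [kd|dk] := ltnP k d; last first.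
  exists U => // a l; rewrite ltnS leq_eqVlt => /orP[/eqP ->|]; last exact: IH.
  by move=> kl; have := leq_trans kl (ltnW (leq_trans (ltn_ord l) dk)); rewrite ltnn.
suff: forall m, exists2 W, rotation W & forall (a : 'I_r) (l : 'I_d), (a < l)%N ->
    (a < k)%N || (a == k :> nat) && (l < m)%N -> (V *m W) a l = 0.
  move=> /(_ d)[W rW h]; exists W => // a l ak al; apply: h => //.
  by rewrite ltn_ord andbT orbC -leq_eqVlt.
elim=> [|m [W rW h]].
  by exists U => // a l al; rewrite ltn0 andbF orbF => ak; exact: IH.
have [km|mk] := ltnP k m; last first.
  exists W => // a l al /orP[ak|/andP[/eqP ak lm]]; first by apply: h; rewrite ?ak.
  by move: lm; rewrite ltnS => lm; have := leq_trans lm mk; rewrite -ak leqNgt al.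
have [md|dm] := ltnP m d; last first.
  exists W => // a l al /orP[ak|/andP[/eqP ak lm]]; first by apply: h; rewrite ?ak.
  by apply: h => //; rewrite ak eqxx (leq_trans (ltn_ord l) dm) orbT.
have kmd : Ordinal kd != Ordinal md by rewrite -val_eqE /= ltn_eqF.
have [G [rG h1 h2 h3]] := rotation_eliminate (V *m W) (Ordinal kr) kmd.
exists (W *m G); first exact: rotationM.
move=> a l al hal; rewrite mulmxA.
case/orP: hal => [ak|/andP[/eqP ak lm]].
  have [g1 g2] : (V *m W *m G) a (Ordinal kd) = 0 /\ (V *m W *m G) a (Ordinal md) = 0.
    by apply: h3; apply: h; rewrite /= ?ak// (ltn_trans ak).
  have [->//|lk] := eqVneq l (Ordinal kd); have [->//|lm] := eqVneq l (Ordinal md).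
  by rewrite h2//; apply: h; rewrite ?ak.
have -> : a = Ordinal kr by apply: val_inj.
have [->//|lm'] := eqVneq l (Ordinal md).
rewrite h2//.
  apply: h => /=; first by rewrite -ak.
  rewrite eqxx ltnn /=; move: lm; rewrite ltnS leq_eqVlt => /orP[/eqP e|//].
  by move: lm'; rewrite -val_eqE /= e eqxx.
by apply/eqP => lk; move: al; rewrite lk /= ak ltnn.
Qed.

(** * Conditional bounds, two-row moment generating functions, almost sure invertibility *)

Lemma measurable_event (R : realType) (d : measure_display) (T : measurableType d)
    (I : finType) (X : I -> T -> measurableTypeR R) (F : set (sample R I)) :
  (forall i, measurable_fun setT (X i)) -> measurable F ->
  measurable [set w | F (fun i => X i w)].
Proof.
by move=> mX mF; have := measurable_sample mX measurableT mF; rewrite setTI.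
Qed.

Lemma iidN_freeze_le (R : realType) (d : measure_display) (T : measurableType d)
    (P : probability T R) (I : finType) (X : I -> T -> measurableTypeR R) (A : pred I)
    (F : set (sample R I)) (b : \bar R) :
  iidN P X -> measurable F -> (0 <= b)%E ->
  (forall w', (P [set w | F (fun i => if A i then X i w else X i w')] <= b)%E) ->
  (P [set w | F (fun i => X i w)] <= b)%E.
Proof.
move=> iX mF b0 hb; have mX := iX.1.
have mh : measurable_fun setT (fun x : sample R I => (\1_F x : R)%:E).
  exact/measurable_EFinP/measurable_indic.
have -> : P [set w | F (fun i => X i w)] =
    (\int[P]_w (\1_F (fun i => X i w) : R)%:E)%E.
  by rewrite -[in LHS](setIT [set w | _]) -(integral_indic P)//; exact: measurable_event.
rewrite (iidN_freeze A iX mh); last by move=> x; rewrite lee_fin indicE ler0n.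
have mM := (iidN_mix A iX).1.
have -> : b = (\int[P]_w' cst b w')%E.
  rewrite integral_cst// -[LHS]mule1; congr (_ * _)%E.
  by apply/esym; exact: probability_setT.
apply: ge0_le_integral => //.
- by move=> w' _; apply: integral_ge0 => w _; rewrite lee_fin indicE ler0n.
- apply: (measurable_fun_fubini_tonelli_F (m2 := P) (fun z : T * T =>
    (\1_F (fun i => if A i then X i z.2 else X i z.1) : R)%:E)).
    by apply: (measurableT_comp mh); exact: measurable_sample.
  by move=> z; rewrite lee_fin indicE ler0n.
- move=> w' _; pose E := [set w | F (fun i => if A i then X i w else X i w')].
  have mE : measurable E.
    apply: (measurable_event (X := fun i w => if A i then X i w else X i w')) => // i.
    by case: (A i) => //; exact: measurable_cst.
  have := integral_indic P measurableT mE; rewrite setIT => e.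
  by apply: le_trans (hb w'); rewrite -[leRHS]e; exact: lexx.
Qed.

Lemma iidN_reindex (R : realType) (d : measure_display) (T : measurableType d)
    (P : probability T R) (I J : finType) (e : J -> I) (X : I -> T -> measurableTypeR R) :
  injective e -> iidN P X -> iidN P (fun j => X (e j)).
Proof.
move=> inj_e [mX PX]; split=> // B mB.
pose C i := if [pick j | e j == i] is Some j then B j else setT.
have CE j : C (e j) = B j.
  rewrite /C; case: pickP => [k /eqP/inj_e -> //|/(_ j)]; by rewrite eqxx.
have -> : [set w | forall j, B j (X (e j) w)] = [set w | forall i, C i (X i w)].
  apply/seteqP; split => w /= h i; last by rewrite -CE; exact: h.
  by rewrite /C; case: pickP => [k /eqP <-|_]; [exact: h|].
rewrite PX; last by move=> i; rewrite /C; case: pickP => [k _|_]; [exact: mB|exact: measurableT].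
rewrite (bigID (mem (e @: finset.setTfor J)))/= [X in (_ * X)%E]big1 ?mule1; last first.
  move=> i ei; rewrite /C; case: pickP => [k /eqP eki|_].
    by move: ei; rewrite -eki imset_f// inE.
  exact: probability_setT.
rewrite big_imset/=; last by move=> j k _ _; exact: inj_e.
by apply: eq_big => [j|j _]; [rewrite finset.in_setT|rewrite CE].
Qed.

(** Freezing row [q] makes the inner integral a product over single coordinates of row [p]; the
    outer one is then such a product over row [q]. *)
Lemma iidN_integral_prod_rows (R : realType) (d0 : measure_display) (T : measurableType d0)
    (P : probability T R) (J K : finType) (X : J * K -> T -> measurableTypeR R)
    (p q : J) (f : K -> measurableTypeR R * measurableTypeR R -> \bar R) :
  p != q -> iidN P X -> (forall k, measurable_fun setT (f k)) ->
  (forall k z, (0 <= f k z)%E) ->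
  (\int[P]_w \prod_k f k (X (p, k) w, X (q, k) w) =
   \prod_k \int[normal_prob 0 1]_v \int[normal_prob 0 1]_u f k (u, v))%E.
Proof.
move=> pq iX mf f0; have mX := iX.1.
have iXp (r : J) : iidN P (fun k => X (r, k)).
  by apply: (iidN_reindex (e := fun k => (r, k))) => // j k [].
have mprod (s : seq K) : measurable_fun setT
    (fun x : sample R (J * K)%type => (\prod_(k <- s) f k (x (p, k), x (q, k)))%E).
  elim: s => [|k s IH].
    by apply: (eq_measurable_fun (fun=> 1%E)) => [x _|//]; rewrite big_nil.
  apply: (eq_measurable_fun (fun x : sample R (J * K)%type =>
    f k (x (p, k), x (q, k)) * \prod_(k <- s) f k (x (p, k), x (q, k)))%E) => [x _|].
    by rewrite big_cons.
  apply: emeasurable_funM => //; apply: (measurableT_comp (mf k)).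
  by apply: measurable_fun_pair; exact: measurable_coord.
have prod0 (x : sample R (J * K)%type) : (0 <= \prod_k f k (x (p, k), x (q, k)))%E.
  by elim/big_ind: _ => // a b; exact: mule_ge0.
rewrite (iidN_freeze (fun jk => jk.1 == p) iX (mprod _) prod0) /= eqxx eq_sym (negbTE pq).
transitivity (\int[P]_w' \prod_k (\int[normal_prob 0 1]_u f k (u, X (q, k) w')))%E.
  apply: eq_integral => w' _.
  rewrite (iidN_integral_prod (f := fun k u => f k (u, X (q, k) w')) (iXp p))// => k.
  by apply: (measurableT_comp (mf k)); exact: measurable_fun_pair.
rewrite (iidN_integral_prod (f := fun k v => (\int[normal_prob 0 1]_u f k (u, v))%E) (iXp q))//.
- by move=> k; exact: (measurable_fun_fubini_tonelli_G (m1 := normal_prob 0 1) (f k)).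
- by move=> k v; exact: integral_ge0.
Qed.

(** Integrating out row [p] turns [s k * u * v] into [s k ^+ 2 * v ^+ 2 / 2], which merely lowers
    [t k] by [s k ^+ 2]. The case [t = 0] handles off-diagonal Gram entries; the quadratic term is
    for the comparison of [|q|^2] with [tau p.q]. *)
Lemma iidN_mgf (R : realType) (d0 : measure_display) (T : measurableType d0)
    (P : probability T R) (J K : finType) (X : J * K -> T -> measurableTypeR R)
    (p q : J) (s t : K -> R) :
  p != q -> iidN P X -> (forall k, 0 < 1 + t k - s k ^+ 2) ->
  (\int[P]_w (expR (\sum_k (s k * (X (p, k) w * X (q, k) w)
                            - t k * X (q, k) w ^+ 2 / 2)))%:E =
   (\prod_k (Num.sqrt (1 + t k - s k ^+ 2))^-1)%:E)%E.
Proof.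
move=> pq iX st0.
pose f k (z : measurableTypeR R * measurableTypeR R) : \bar R :=
  (expR (s k * (z.1 * z.2) - t k * z.2 ^+ 2 / 2))%:E.
transitivity (\int[P]_w \prod_k f k (X (p, k) w, X (q, k) w))%E.
  by apply: eq_integral => w _; rewrite expR_sum prodEFin.
rewrite (iidN_integral_prod_rows pq iX)//; last 2 first.
- move=> k; apply/measurable_EFinP; apply: measurableT_comp => //.
  apply: measurable_funB; first by apply: measurable_funM => //; exact: measurable_funM.
  apply: measurable_funM => //; apply: measurable_funM => //.
  by apply: measurable_funX.
- by move=> k z; rewrite lee_fin expR_ge0.
rewrite -prodEFin; apply: eq_bigr => k _.
transitivity (\int[normal_prob 0 1]_(v in [set: measurableTypeR R])
   (expR (0 * v - (t k - s k ^+ 2) * v ^+ 2 / 2))%:E)%E.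
  apply: eq_integral => v _.
  transitivity (\int[normal_prob 0 1]_(u in [set: measurableTypeR R])
     ((expR (- (t k * v ^+ 2 / 2)))%:E * (expR (s k * v * u - 0 * u ^+ 2 / 2))%:E))%E.
    apply: eq_integral => u _; rewrite /f/= -EFinM -expRD; congr (expR _)%:E; ring.
  rewrite ge0_integralZl//; last first.
    apply/measurable_EFinP; apply: measurableT_comp => //.
    apply: measurable_funB; first exact: measurable_funM.
    by apply: measurable_funM => //; apply: measurable_funM => //.
  rewrite integral_expR_normal_prob ?addr0// -EFinM sqrtr1 divr1 -expRD.
  by congr (expR _)%:E; field.
rewrite integral_expR_normal_prob; last by rewrite addrA.
by rewrite expr0n mul0r expR0 mul1r addrA.
Qed.

Lemma measurable_det (R : realType) (d : measure_display) (T : measurableType d)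
    (n : nat) (M : T -> 'M[R]_n) :
  (forall i j, measurable_fun setT (fun x => M x i j : measurableTypeR R)) ->
  measurable_fun setT (fun x => \det (M x) : measurableTypeR R).
Proof.
move=> mM; rewrite /determinant.
apply: measurable_sum => s; apply: measurable_funM; first exact: measurable_cst.
by apply: measurable_prod => i _; exact: mM.
Qed.

Lemma normal_prob_set1 (R : realType) (x : R) : normal_prob 0 1 [set x : measurableTypeR R] = 0%E.
Proof.
have /null_content_dominatesP := @normal_prob_dominates R 0 1.
by apply; [exact: measurable_set1|exact: lebesgue_measure_set1].
Qed.

(** Induction on the size: with only the corner entry left random, the minor is an affine function
    of it whose slope is the previous minor. Where that slope is nonzero there is a single root, and
    a point has Gaussian measure zero. *)
Lemma iidN_minor (R : realType) (d0 : measure_display) (T : measurableType d0)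
    (P : probability T R) (n d : nat) (X : 'I_n * 'I_d -> T -> measurableTypeR R)
    (k : nat) (kn : (k <= n)%N) (kd : (k <= d)%N) : iidN P X ->
  P [set w | \det (\matrix_(i < k, j < k) X (widen_ord kn i, widen_ord kd j) w) = 0] = 0%E.
Proof.
move=> iX; elim: k kn kd => [|k IH] kn kd.
  rewrite (_ : [set w | _] = set0) ?measure0//.
  by apply/seteqP; split => w //=; rewrite det_mx00 => /eqP; rewrite oner_eq0.
have kn' := ltnW kn; have kd' := ltnW kd.
pose M (x : sample R ('I_n * 'I_d)%type) m (mn : (m <= n)%N) (md : (m <= d)%N) : 'M[R]_m :=
  \matrix_(i, j) x (widen_ord mn i, widen_ord md j).
have mM m (mn : (m <= n)%N) (md : (m <= d)%N) :
    measurable_fun setT (fun x => \det (M x m mn md) : measurableTypeR R).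
  apply: measurable_det => i j.
  apply: (eq_measurable_fun (fun x : sample R ('I_n * 'I_d)%type =>
    x (widen_ord mn i, widen_ord md j))) => [x _|]; first by rewrite mxE.
  exact: measurable_coord.
have mZ m (mn : (m <= n)%N) (md : (m <= d)%N) : measurable [set x | \det (M x m mn md) = 0].
  by have := mM m mn md measurableT [set 0] (measurable_set1 _); rewrite setTI.
pose F : set (sample R ('I_n * 'I_d)%type) :=
  [set x | \det (M x _ kn kd) = 0] `\` [set x | \det (M x _ kn' kd') = 0].
have mF : measurable F by apply: measurableD; exact: mZ.
have mX := iX.1.
apply/eqP; rewrite eq_le measure_ge0 andbT.
have sub : [set w | \det (M (fun ij => X ij w) _ kn kd) = 0] `<=`
    [set w | \det (M (fun ij => X ij w) _ kn' kd') = 0] `|` [set w | F (fun ij => X ij w)].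
  move=> w /= h; have [h'|h'] := pselect (\det (M (fun ij => X ij w) _ kn' kd') = 0).
    by left.
  by right.
have m1 := measurable_event mX (mZ _ kn' kd'); have m2 := measurable_event mX mF.
apply: (@le_trans _ _ (P ([set w | \det (M (fun ij => X ij w) _ kn' kd') = 0] `|`
    [set w | F (fun ij => X ij w)]))).
  apply: le_measure => //; rewrite inE; last exact: measurableU.
  exact: (measurable_event mX (mZ _ kn kd)).
apply: le_trans (measureU2 _ m1 m2) _.
rewrite [X in (X + _)%E](_ : _ = 0%E) ?add0e; last exact: IH.
pose kk := (widen_ord kn ord_max, widen_ord kd ord_max).
apply: (iidN_freeze_le (A := pred1 kk) iX mF) => // w'.
have MM x : row' ord_max (col' ord_max (M x _ kn kd)) = M x _ kn' kd'.
  apply/matrixP => i j; rewrite !mxE; congr (x (_, _)); apply: val_inj => /=;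
  by rewrite /bump leqNgt ltn_ord.
have MO (i j : 'I_k.+1) (w : T) : (i != ord_max) || (j != ord_max) ->
    M (fun ij => if pred1 kk ij then X ij w else X ij w') _ kn kd i j =
    M (fun ij => X ij w') _ kn kd i j.
  move=> ij; rewrite !mxE /= xpair_eqE -!val_eqE /=; case: ifP => // /andP[/eqP e1 /eqP e2].
  by move: ij; rewrite -!val_eqE /= e1 e2 eqxx.
pose N := M (fun ij => X ij w') _ kn kd.
pose a := \det (M (fun ij => X ij w') _ kn' kd').
pose b := \sum_(j < k.+1 | j != ord_max) N ord_max j * cofactor N ord_max j.
have cofE w j : cofactor (M (fun ij => if pred1 kk ij then X ij w else X ij w') _ kn kd) ord_max j
    = cofactor N ord_max j.
  rewrite /cofactor; congr (_ * \det _); apply/matrixP => i l.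
  by rewrite [LHS]mxE [LHS]mxE [RHS]mxE [RHS]mxE MO// eq_sym neq_lift.
have detE w : \det (M (fun ij => if pred1 kk ij then X ij w else X ij w') _ kn kd) =
    X kk w * a + b.
  rewrite (expand_det_row _ ord_max) (bigD1 ord_max)//=; congr (_ + _).
    rewrite cofE; congr (_ * _); first by rewrite !mxE /= eqxx.
    by rewrite /cofactor addnn -signr_odd odd_double expr0 mul1r MM.
  by apply: eq_bigr => j jm; rewrite cofE MO// jm orbT.
have minorE w : \det (M (fun ij => if pred1 kk ij then X ij w else X ij w') _ kn' kd') = a.
  rewrite /a -!MM; congr (\det _); apply/matrixP => i l.
  by rewrite [LHS]mxE [LHS]mxE [RHS]mxE [RHS]mxE MO// eq_sym neq_lift.
have mN1 : measurable [set (- b / a : measurableTypeR R)] by exact: measurable_set1.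
apply: (@le_trans _ _ (P (X kk @^-1` [set (- b / a : measurableTypeR R)]))); last first.
  by rewrite (iidN_coord kk iX mN1) normal_prob_set1.
apply: le_measure; rewrite ?inE.
- apply: (measurable_event (X := fun ij w => if pred1 kk ij then X ij w else X ij w')) => // i.
  by case: (pred1 kk i) => //; exact: measurable_cst.
- by rewrite -[X in measurable X]setTI; exact: mX.
move=> w [/=]; rewrite detE minorE => h1 /eqP a0.
apply: (mulIf a0); rewrite divfK//; apply/eqP; rewrite -subr_eq0 opprK.
by apply/eqP.
Qed.

(** * Deterministic part: dual certificates and signs of multipliers *)

(** The signs give [a.a <= a.b] for every feasible [b], hence [|a - b|^2 <= |b|^2 - |a|^2]. This one
    inequality shows both that [a] is optimal and that every optimal [b] equals it. *)
Lemma svm_interpolates_dual (R : realType) (n d : nat) (Phi : 'M[R]_(n, d)) (Y c : 'cV[R]_n) :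
  pm1_vector Y -> Phi *m Phi^T *m c = Y -> (forall i, 0 <= Y i 0 * c i 0) ->
  svm_interpolates Phi Y.
Proof.
move=> pmY Kc Yc; pose a := Phi^T *m c.
have Pa : Phi *m a = Y by rewrite mulmxA.
have Y2 i : Y i 0 * Y i 0 = 1 by case: (pmY i) => ->; rewrite ?mulrNN mulr1.
have dotE (b : 'cV[R]_d) : \sum_j a j 0 * b j 0 = \sum_i c i 0 * (Phi *m b) i 0.
  transitivity ((a^T *m b) 0 0); first by rewrite [RHS]mxE; apply: eq_bigr => j _; rewrite [a^T _ _]mxE.
  by rewrite trmx_mul trmxK -mulmxA [LHS]mxE; apply: eq_bigr => j _; rewrite [c^T _ _]mxE.
have dist (b : 'cV[R]_d) : svm_feasible Phi Y b ->
    \sum_j (a j 0 - b j 0) ^+ 2 <= \sum_j b j 0 ^+ 2 - \sum_j a j 0 ^+ 2.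
  move=> fb.
  have le_dot : \sum_j a j 0 * a j 0 <= \sum_j a j 0 * b j 0.
    rewrite !dotE Pa; apply: ler_sum => i _.
    have -> : c i 0 * (Phi *m b) i 0 = (Y i 0 * c i 0) * (Y i 0 * (Phi *m b) i 0).
      by rewrite mulrACA Y2 mul1r.
    by rewrite mulrC ler_peMr// fb.
  have -> : \sum_j (a j 0 - b j 0) ^+ 2 = \sum_j b j 0 ^+ 2 - \sum_j a j 0 ^+ 2
      + 2 * (\sum_j a j 0 * a j 0 - \sum_j a j 0 * b j 0).
    rewrite -!sumrB mulr_sumr -big_split/=; apply: eq_bigr => j _; ring.
  by rewrite gerDl pmulr_rle0// subr_le0.
have sq_ge0 (b : 'cV[R]_d) : 0 <= \sum_j b j 0 ^+ 2.
  by apply: sumr_ge0 => j _; exact: sqr_ge0.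
have fa : svm_feasible Phi Y a by move=> i; rewrite Pa Y2.
split.
  exists a; split=> // b fb; rewrite ler_sqrt// -subr_ge0.
  by apply: le_trans _ (dist _ fb); apply: sumr_ge0 => j _; exact: sqr_ge0.
move=> b [fb minb].
have ba : \sum_j b j 0 ^+ 2 <= \sum_j a j 0 ^+ 2 by rewrite -ler_sqrt//; exact: minb.
have /eqP : \sum_j (a j 0 - b j 0) ^+ 2 = 0.
  apply/eqP; rewrite eq_le sumr_ge0 ?andbT => [|j _]; last exact: sqr_ge0.
  by apply: le_trans (dist _ fb) _; rewrite subr_le0.
rewrite psumr_eq0 => [/allP ab|j _]; last exact: sqr_ge0.
rewrite -Pa; congr (_ *m _); apply/matrixP => j k; rewrite [k]ord1.
by have := ab j (mem_index_enum _); rewrite /= sqrf_eq0 subr_eq0 => /eqP.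
Qed.

(** In the row where [|c|] is largest, the diagonal term exceeds the off-diagonal part enough to
    give [kappa / 2 * max |c| <= B]; and the left side bounds the off-diagonal part of every row. *)
Lemma diag_dominant_bound (R : realType) (n : nat) (K : 'M[R]_n) (kappa B : R)
    (c : 'cV[R]_n) : 0 < kappa -> (forall i, kappa <= K i i) ->
  (forall i j, i != j -> `|K i j| <= kappa / (2 * n%:R)) ->
  (forall i, `|(K *m c) i 0| <= B) ->
  forall i, \sum_(j | j != i) `|K i j * c j 0| <= B.
Proof.
move=> k0 Kii Kij hB i0.
pose i := [arg max_(i > i0) `|c i 0|]%O.
have ci j : `|c j 0| <= `|c i 0|.
  by rewrite /i; case: Order.TotalTheory.arg_maxP => // l _; exact.
have n0 : (0 : R) < n%:R by rewrite ltr0n; exact: leq_ltn_trans (ltn_ord i0).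
have off l : \sum_(j | j != l) `|K l j * c j 0| <= kappa / 2 * `|c i 0|.
  apply: (@le_trans _ _ (\sum_(j < n) kappa / (2 * n%:R) * `|c i 0|)).
    rewrite [leRHS](bigD1 l)//= ler_wpDl//.
      by rewrite mulr_ge0// divr_ge0 ?mulr_ge0 ?ler0n// ltW.
    by apply: ler_sum => j jl; rewrite normrM ler_pM// Kij// eq_sym.
  rewrite sumr_const card_ord -mulr_natl; rewrite le_eqVlt; apply/orP; left; apply/eqP.
  by field; rewrite gt_eqF.
apply: le_trans (off i0) _.
suff : kappa * `|c i 0| <= B + kappa / 2 * `|c i 0|.
  by rewrite -lerBlDr -mulrBl; congr (_ * _ <= _); field.
apply: (@le_trans _ _ `|K i i * c i 0|).
  rewrite normrM ler_wpM2r// ger0_norm ?Kii//; exact: le_trans (ltW k0) (Kii i).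
have -> : K i i * c i 0 = (K *m c) i 0 - \sum_(j | j != i) K i j * c j 0.
  by rewrite mxE (bigD1 i)//= addrK.
apply: le_trans (ler_normB _ _) _; apply: lerD => //.
exact: le_trans (ler_norm_sum _ _ _) (off i).
Qed.

(** The row bound is used twice: with [B = 0] it makes the kernel trivial; with [B = 1] the
    off-diagonal part of a row is at most [|Y i 0| = 1], so it cannot push [K i i * c i 0] across
    zero. *)
Lemma diag_dominant_sign (R : realType) (n : nat) (K : 'M[R]_n) (kappa : R)
    (Y : 'cV[R]_n) : 0 < kappa -> (forall i, kappa <= K i i) ->
  (forall i j, i != j -> `|K i j| <= kappa / (2 * n%:R)) -> pm1_vector Y ->
  exists2 c : 'cV[R]_n, K *m c = Y & forall i, 0 <= Y i 0 * c i 0.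
Proof.
move=> k0 Kii Kij pmY.
have Kpos i : 0 < K i i by exact: lt_le_trans (Kii i).
have uK : K \in unitmx.
  rewrite unitmxE unitfE -det_tr; apply/negP => /det0P[v v0 vK].
  have Kv : K *m v^T = 0 by rewrite -[LHS]trmxK trmx_mul trmxK vK trmx0.
  have hB i : `|(K *m v^T) i 0| <= 0 by rewrite Kv mxE normr0.
  move/eqP: v0; apply; apply/matrixP => k i; rewrite ord1 [RHS]mxE.
  have off := diag_dominant_bound k0 Kii Kij hB i.
  have : K i i * v^T i 0 = 0.
    have : (K *m v^T) i 0 = 0 by rewrite Kv mxE.
    rewrite mxE (bigD1 i)//= [X in _ + X](_ : _ = 0) ?addr0//.
    apply/eqP; rewrite -normr_le0; exact: le_trans (ler_norm_sum _ _ _) off.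
  by move/eqP; rewrite mulf_eq0 gt_eqF//= mxE => /eqP.
exists (invmx K *m Y); first by rewrite mulmxA mulmxV// mul1mx.
move=> i; set c := invmx K *m Y.
have Kc : K *m c = Y by rewrite /c mulmxA mulmxV// mul1mx.
clearbody c.
have Y1 j : `|Y j 0| = 1 by case: (pmY j) => ->; rewrite ?normrN normr1.
have Y2 : Y i 0 * Y i 0 = 1 by case: (pmY i) => ->; rewrite ?mulrNN mulr1.
have off := diag_dominant_bound k0 Kii Kij (B := 1) (c := c) _ i.
rewrite -(pmulr_rge0 _ (Kpos i)) mulrCA.
have -> : K i i * c i 0 = Y i 0 - \sum_(j | j != i) K i j * c j 0.
  by rewrite -[in RHS]Kc mxE (bigD1 i)//= addrK.
rewrite mulrBr Y2 subr_ge0.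
apply: le_trans (ler_norm _) _; rewrite normrM Y1 mul1r.
apply: le_trans (ler_norm_sum _ _ _) (off _) => j.
by rewrite Kc Y1.
Qed.

(* With [a = X^T c], the rows below the first two kill the head of [a], so that its
   tail [c_0 p + c_1 q] solves a two-dimensional Gram system. *)
Lemma negative_multiplier_tail (R : realType) (r p : nat) (X : 'M[R]_(2 + r, r + p))
    (c : 'cV[R]_(2 + r)) (tau : R) :
  (forall l k, X (rshift 2 l) (rshift r k) = 0) -> X *m X^T \in unitmx ->
  (X *m X^T *m c = \col_i (if i == lshift r 0 then 1 else
                           if i == lshift r 1 then tau else 0)) ->
  c (lshift r 0) 0 < 0 ->
  \sum_k X (lshift r 1) (rshift r k) ^+ 2 <=
  tau * \sum_k X (lshift r 0) (rshift r k) * X (lshift r 1) (rshift r k).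
Proof.
move=> V0 uK Kc c0.
pose a := X^T *m c; pose L := lsubmx (dsubmx X).
have Vr : rsubmx (dsubmx X) = 0 by apply/matrixP => l k; rewrite !mxE V0.
(* A left null vector of [L], padded by two zeros, would be one of [X], hence of its invertible Gram
   matrix. *)
have uL : L \in unitmx.
  rewrite unitmxE unitfE; apply/negP => /det0P[v v0 vL].
  move/eqP: v0; apply.
  have vV : v *m dsubmx X = 0.
    by rewrite -[dsubmx X]hsubmxK Vr mul_mx_row vL mulmx0 row_mx0.
  have : row_mx 0 v *m X = 0 :> 'rV_(r + p).
    by rewrite -[X]vsubmxK mul_row_col mul0mx add0r.
  move=> /(congr1 (fun M => M *m X^T)); rewrite mul0mx -mulmxA => h.
  have := mulmxK uK (row_mx 0 v : 'rV_(2 + r)); rewrite h mul0mx.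
  by move=> /esym/(congr1 rsubmx); rewrite row_mxKr => ->; apply/matrixP => i j; rewrite !mxE.
have Xa : X *m a = \col_i (if i == lshift r 0 then 1 else
    if i == lshift r 1 then tau else 0) by rewrite mulmxA.
have a1 : usubmx a = 0.
  have : dsubmx X *m a = 0.
    rewrite mul_dsub_mx Xa; apply/matrixP => l k; rewrite !mxE.
    by rewrite -!val_eqE.
  rewrite -[dsubmx X]hsubmxK -[a]vsubmxK mul_row_col Vr mul0mx addr0 => La.
  by rewrite col_mxKu -(mulKmx uL (usubmx a)) La mulmx0.
have a1k k : a (lshift p k) 0 = 0 by have := congr1 (fun M : 'cV[R]_r => M k 0) a1; rewrite [LHS]mxE [RHS]mxE.
pose P k := X (lshift r 0) (rshift r k); pose Q k := X (lshift r 1) (rshift r k).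
have a2k k : a (rshift r k) 0 = c (lshift r 0) 0 * P k + c (lshift r 1) 0 * Q k.
  rewrite mxE big_split_ord /= [X in _ + X]big1 ?addr0 => [|l _]; last first.
    by rewrite mxE V0 mul0r.
  rewrite !big_ord_recl big_ord0 addr0 !mxE mulrC; congr (_ + _).
  by rewrite mulrC; congr (c _ _ * X _ _); apply: val_inj.
have rowE (i : 'I_(2 + r)) : (X *m a) i 0 = \sum_k X i (rshift r k) * a (rshift r k) 0.
  rewrite mxE big_split_ord /= big1 ?add0r// => k _; by rewrite a1k mulr0.
have e0 : c (lshift r 0) 0 * (\sum_k P k ^+ 2) + c (lshift r 1) 0 * (\sum_k P k * Q k) = 1.
  have := rowE (lshift r 0); rewrite Xa mxE eqxx => ->.
  rewrite !mulr_sumr -big_split/=; apply: eq_bigr => k _; rewrite a2k -/(P k); ring.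
have e1 : c (lshift r 0) 0 * (\sum_k P k * Q k) + c (lshift r 1) 0 * (\sum_k Q k ^+ 2) = tau.
  have := rowE (lshift r 1); rewrite Xa mxE /= => ->.
  rewrite !mulr_sumr -big_split/=; apply: eq_bigr => k _; rewrite a2k -/(Q k); ring.
set pp := \sum_k P k ^+ 2 in e0; set pq := \sum_k P k * Q k in e0 e1.
set qq := \sum_k Q k ^+ 2 in e1.
(* Cauchy-Schwarz for the two tails, from the square of [qq P - pq Q]; the case [qq = 0] is separate
   because [qq] is divided out. *)
have CS : 0 <= pp * qq - pq ^+ 2.
  have qq0 : 0 <= qq by apply: sumr_ge0 => k _; exact: sqr_ge0.
  have id (x y : R) : \sum_k (x * P k + y * Q k) ^+ 2 =
      x ^+ 2 * pp + 2 * x * y * pq + y ^+ 2 * qq.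
    rewrite !mulr_sumr -!big_split/=; apply: eq_bigr => k _; ring.
  have id0 (x y : R) : 0 <= x ^+ 2 * pp + 2 * x * y * pq + y ^+ 2 * qq.
    by rewrite -id; apply: sumr_ge0 => k _; exact: sqr_ge0.
  have [q0|qn0] := eqVneq qq 0.
    have pq0 : pq = 0.
      apply: big1 => k _.
      have := @psumr_eq0P _ _ xpredT (fun k => Q k ^+ 2) (fun k _ => sqr_ge0 _) q0 k isT.
      by move=> /eqP; rewrite sqrf_eq0 => /eqP ->; rewrite mulr0.
    by rewrite q0 pq0 mulr0 expr0n subr0.
  have := id0 qq (- pq).
  have -> : qq ^+ 2 * pp + 2 * qq * - pq * pq + (- pq) ^+ 2 * qq =
    qq * (pp * qq - pq ^+ 2) by ring.
  by rewrite pmulr_rge0// lt_def qn0.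
(* Cramer's rule for [c_0] in the system [e0], [e1]: the Gram determinant is nonnegative and [c_0]
   negative. *)
rewrite -subr_le0.
have -> : qq - tau * pq = c (lshift r 0) 0 * (pp * qq - pq ^+ 2).
  by rewrite -e1 -[qq]mul1r -{1}e0; ring.
by rewrite nmulr_rle0.
Qed.

(** * Part 2: the probability that a given multiplier is negative *)

(** Square root of [1 + z <= expR z] at [z = - y / (1 + y)]. Negative [y] is included; the
    off-diagonal entries of part 1 use it. *)
Lemma invr_sqrt_le_expR (R : realType) (y : R) : 0 < 1 + y ->
  (Num.sqrt (1 + y))^-1 <= expR (- (y / (2 * (1 + y)))).
Proof.
move=> y0; rewrite -(@ler_pXn2r _ 2)// ?nnegrE ?invr_ge0 ?sqrtr_ge0 ?expR_ge0//.
rewrite exprVn sqr_sqrtr ?(ltW y0)// -expRM_natl.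
have -> : 2 * - (y / (2 * (1 + y))) = - (y / (1 + y)) by field; rewrite gt_eqF.
apply: le_trans _ (expR_ge1Dx _); rewrite le_eqVlt; apply/orP; left; apply/eqP.
by field; rewrite gt_eqF.
Qed.

Lemma markov_expR (R : realType) (d : measure_display) (T : measurableType d)
    (P : probability T R) (f : T -> measurableTypeR R) : measurable_fun setT f ->
  (P [set w | (0 <= f w)%R] <= \int[P]_w (expR (f w))%:E)%E.
Proof.
move=> mf; pose E := [set w | (0 : R) <= f w].
have mE : measurable E.
  rewrite (_ : E = f @^-1` `[0, +oo[%classic).
    by rewrite -[X in measurable X]setTI; exact: mf.
  by apply/seteqP; split => w /=; rewrite in_itv/= andbT.
have := integral_indic P measurableT mE; rewrite setIT => <-.
apply: ge0_le_integral => //.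
- exact/measurable_EFinP/measurable_indic.
- by apply/measurable_EFinP; apply: measurableT_comp.
- move=> w _; rewrite lee_fin indicE.
  have [/set_mem f0|h] := boolP (w \in E); last by rewrite expR_ge0.
  by apply: le_trans _ (expR_ge1Dx _); rewrite lerDl.
Qed.

(* A rotation of the samples carries [e_i] and the rest of [Y] to the first two axes. *)
Lemma negative_multiplier_rotation (R : realType) (r : nat) (Y : 'cV[R]_(2 + r))
    (i : 'I_(2 + r)) : pm1_vector Y ->
  exists U : 'M[R]_(2 + r), exists2 tau : R, rotation U /\ tau ^+ 2 = r.+1%:R &
  forall d (Z : 'M[R]_(2 + r, d)), Z *m Z^T \in unitmx ->
    Y i 0 * (invmx (Z *m Z^T) *m Y) i 0 < 0 ->
    let K := (U^T *m Z) *m (U^T *m Z)^T in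
    K \in unitmx /\ (invmx K *m \col_l (if l == lshift r 0 then 1 else
                              if l == lshift r 1 then tau else 0)) (lshift r 0) 0 < 0.
Proof.
move=> pmY.
have Y2 l : Y l 0 * Y l 0 = 1 by case: (pmY l) => ->; rewrite ?mulrNN mulr1.
(* The rows are [e_i] and [Y] with its [i]th entry erased: orthogonal, of squared lengths 1 and
   [r.+1]. Rotation keeps their inner products, so after triangularisation both rows lie on axes. *)
pose M : 'M[R]_(2, 2 + r) := \matrix_(a, l)
  (if a == 0 then (l == i)%:R else if l == i then 0 else Y l 0).
have [U rU low] := rotation_lower M.
have UtU := rotation_orthogonal rU; have UUt := mulmx1C UtU.
pose N := M *m U.
have trE (A : 'M[R]_(2, 2 + r)) a b : A^T a b = A b a by rewrite mxE.
have NN : N *m N^T = M *m M^T.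
  by rewrite trmx_mul mulmxA -(mulmxA M) UUt mulmx1.
have NNE a b : (N *m N^T) a b = \sum_l M a l * M b l.
  by rewrite NN [LHS]mxE; apply: eq_bigr => l _; rewrite trE.
pose z0 : 'I_(2 + r) := lshift r 0; pose z1 : 'I_(2 + r) := lshift r 1.
have N0 l : l != z0 -> N 0 l = 0.
  by move=> lz; apply: low; rewrite lt0n; apply: contra lz => /eqP l0; apply/eqP/val_inj.
have N1 l : l != z0 -> l != z1 -> N 1 l = 0.
  move=> l0 l1; apply: low; rewrite ltn_neqAle lt0n; apply/andP; split.
    by apply: contra l1 => /eqP h; apply/eqP/val_inj.
  by apply: contra l0 => /eqP h; apply/eqP/val_inj.
have z10 : z1 != z0 by [].
have row0 b : (N *m N^T) 0 b = N 0 z0 * N b z0.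
  rewrite mxE (bigD1 z0)//= big1 ?addr0; first by rewrite trE.
  by move=> l lz; rewrite N0// mul0r.
have M0 l : M 0 l = (l == i)%:R by rewrite mxE.
have M00 : \sum_l M 0 l * M 0 l = 1.
  rewrite (bigD1 i)//= !mxE !eqxx mulr1 big1 ?addr0// => l /negbTE li.
  by rewrite mxE/= li mul0r.
have M01 : \sum_l M 0 l * M 1 l = 0.
  apply: big1 => l _; rewrite !mxE/=; case: eqP => _; first by rewrite mulr0.
  by rewrite mul0r.
have M11 : \sum_l M 1 l * M 1 l = r.+1%:R.
  rewrite (bigD1 i)//= !mxE/= eqxx mulr0 add0r.
  transitivity (\sum_(l < 2 + r | l != i) (1 : R)).
    by apply: eq_bigr => l /negbTE li; rewrite mxE/= li Y2.
  rewrite sumr_const; congr (_%:R); apply/eqP.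
  by rewrite -(eqn_add2l 1) -[X in (X + _)%N](card1 i) cardC card_ord.
have a2 : N 0 z0 * N 0 z0 = 1 by rewrite -row0 NNE.
have a0 : N 0 z0 != 0.
  by apply/eqP => h; move: a2; rewrite h mul0r => /eqP; rewrite eq_sym oner_eq0.
have N10 : N 1 z0 = 0.
  have : N 0 z0 * N 1 z0 = 0 by rewrite -row0 NNE.
  by move/eqP; rewrite mulf_eq0 (negbTE a0) => /eqP.
have b2 : N 1 z1 * N 1 z1 = r.+1%:R.
  rewrite -M11 -NNE [RHS]mxE (bigD1 z1)//= big1 ?addr0 => [|l l1]; first by rewrite trE.
  have [->|l0] := eqVneq l z0; first by rewrite N10 mul0r.
  by rewrite N1// mul0r.
(* The rotation may carry [e_i] to minus the first axis. Scaling by [sg] absorbs that sign and the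
   sign of [Y i 0]: the right-hand side becomes 1 on the first axis, and the first multiplier
   becomes [Y i 0 * c0 i 0]. *)
pose sg := Y i 0 * N 0 z0.
have sg2 : sg * sg = 1 by rewrite /sg mulrACA Y2 a2 mulr1.
exists U, (sg * N 1 z1); first by split=> //; rewrite expr2 mulrACA sg2 b2 mul1r.
move=> d Z uZ neg /=.
pose c0 := invmx (Z *m Z^T) *m Y; pose c := sg *: (U^T *m c0).
have KE : (U^T *m Z) *m (U^T *m Z)^T = U^T *m (Z *m Z^T) *m U.
  by rewrite trmx_mul trmxK !mulmxA.
have uU : U \in unitmx by case/mulmx1_unit: UtU.
have uK : (U^T *m Z) *m (U^T *m Z)^T \in unitmx.
  by rewrite KE !unitmx_mul unitmx_tr uU uZ.
split=> //.
have UY l : (U^T *m Y) l 0 = Y i 0 * N 0 l + N 1 l.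
  rewrite [LHS]mxE [N 0 l]mxE [N 1 l]mxE mulr_sumr -big_split/=.
  apply: eq_bigr => k _; rewrite !mxE/=; case: (eqVneq k i) => [->|_] /=; ring.
have Kc : (U^T *m Z) *m (U^T *m Z)^T *m c =
    \col_l (if l == lshift r 0 then 1 else if l == lshift r 1 then sg * N 1 z1 else 0).
  rewrite KE /c -scalemxAr -!mulmxA (mulmxA U) UUt mul1mx.
  rewrite (mulmxA Z) (mulmxA (Z *m Z^T)) mulmxV// mul1mx.
  apply/matrixP => l k; rewrite [k]ord1 [LHS]mxE [RHS]mxE UY.
  rewrite -/z0 -/z1; have [->|l0] := eqVneq l z0; first by rewrite N10 addr0 -/sg sg2.
  rewrite N0// mulr0 add0r; have [->//|l1] := eqVneq l z1.
  by rewrite N1// mulr0.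
rewrite -Kc mulKmx//; move: neg; rewrite -/c0.
suff -> : Y i 0 * c0 i 0 = c (lshift r 0) 0 by [].
rewrite [RHS]mxE -/z0 /sg -mulrA; congr (_ * _).
have <- : (N *m (U^T *m c0)) 0 0 = N 0 z0 * (U^T *m c0) z0 0.
  rewrite mxE (bigD1 z0)//= big1 ?addr0// => l lz; by rewrite N0// mul0r.
rewrite mulmxA /N -(mulmxA M) UUt mulmx1 [RHS]mxE (bigD1 i)//= big1 ?addr0.
  by rewrite M0 eqxx mul1r.
by move=> l /negbTE li; rewrite M0 li mul0r.
Qed.

(** The entries of [\adj M] are polynomials in those of [M]. Multiplied by [\det M] they have the
    signs of the entries of [invmx M] when [M] is invertible and vanish otherwise, so events about
    signs of multipliers become measurable. *)
Lemma measurable_adjugate_mul (R : realType) (d : measure_display) (T : measurableType d)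
    (n : nat) (M : T -> 'M[R]_n) (b : 'cV[R]_n) (i : 'I_n) :
  (forall i j, measurable_fun setT (fun x => M x i j : measurableTypeR R)) ->
  measurable_fun setT (fun x => (\adj (M x) *m b) i 0 : measurableTypeR R).
Proof.
move=> mM.
apply: (eq_measurable_fun (fun x => \sum_j cofactor (M x) j i * b j 0 : measurableTypeR R)).
  by move=> x _; rewrite mxE; apply: eq_bigr => j _; rewrite mxE.
apply: measurable_sum => j; apply: measurable_funM => //; apply: measurable_funM => //.
apply: (@measurable_det _ _ _ _ (fun x => row' j (col' i (M x)))) => k l.
by apply: (eq_measurable_fun (fun x => M x (lift j k) (lift i l))) => [x _|]; [rewrite /= !mxE|exact: mM].
Qed.

Definition sample_mx (R : realType) (n d : nat) (x : 'I_n * 'I_d -> R) : 'M[R]_(n, d) :=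
  \matrix_(i, j) x (i, j).

Lemma measurable_gram (R : realType) (n d : nat) (i j : 'I_n) :
  measurable_fun setT (fun x : sample R ('I_n * 'I_d)%type =>
    (sample_mx x *m (sample_mx x)^T) i j : measurableTypeR R).
Proof.
apply: (eq_measurable_fun (fun x : sample R ('I_n * 'I_d)%type =>
  \sum_k x (i, k) * x (j, k) : measurableTypeR R)).
  by move=> x _; rewrite mxE; apply: eq_bigr => k _; rewrite !mxE.
by apply: measurable_sum => k; apply: measurable_funM; exact: measurable_coord.
Qed.

Lemma prob_negative_multiplier_tail (R : realType) (d0 : measure_display)
    (T : measurableType d0) (P : probability T R) (r p : nat)
    (X : 'I_(2 + r) * 'I_(r + p) -> T -> measurableTypeR R) (tau : R) :
  iidN P X -> tau ^+ 2 = r.+1%:R ->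
  (P [set w | let K := sample_mx (fun ij => X ij w) *m (sample_mx (fun ij => X ij w))^T in
     (\det K * (\adj K *m \col_l (if l == lshift r 0 then 1 else
            if l == lshift r 1 then tau else 0)) (lshift r 0) 0 < 0)%R] <=
   (expR (- (p%:R / (2 * r.+2%:R))))%:E)%E.
Proof.
move=> iX tau2; set b := \col_l _.
pose G (x : sample R ('I_(2 + r) * 'I_(r + p))%type) := sample_mx x *m (sample_mx x)^T.
pose F : set (sample R ('I_(2 + r) * 'I_(r + p))%type) :=
  [set x | (\det (G x) * (\adj (G x) *m b) (lshift r 0) 0 < 0)%R].
have mG i j := @measurable_gram R (2 + r) (r + p) i j.
have mF : measurable F.
  rewrite (_ : F = (fun x => \det (G x) * (\adj (G x) *m b) (lshift r 0) 0 : measurableTypeR R)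
    @^-1` `]-oo, 0[%classic); last by apply/seteqP; split => x /=; rewrite in_itv.
  rewrite -[X in measurable X]setTI.
  apply: (_ : measurable_fun setT (fun x => \det (G x) * (\adj (G x) *m b) (lshift r 0) 0
    : measurableTypeR R)) => //.
  by apply: measurable_funM; [exact: measurable_det|exact: measurable_adjugate_mul].
rewrite [X in (P X <= _)%E](_ : _ = [set w | F (fun ij => X ij w)])//.
apply: (iidN_freeze_le (A := fun ij : 'I_(2 + r) * 'I_(r + p) => (ij.1 < 2)%N) iX mF) => [|w'].
  by rewrite lee_fin expR_ge0.
(* The lower rows are read at the fixed point [w'], so [V] and the rotation [U] found from it are
   deterministic and the law at [w] is preserved. *)
pose V : 'M[R]_(r, r + p) := \matrix_(l, k) X (rshift 2 l, k) w'.
have [U rU low] := rotation_lower V.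
have UtU := rotation_orthogonal rU; have UUt := mulmx1C UtU.
have iX2 := iidN_rotation rU iX.
set X2 := (fun jk w => _) in iX2.
pose z0 : 'I_(2 + r) := lshift r 0; pose z1 : 'I_(2 + r) := lshift r 1.
pose m : R := r.+1%:R.
have m0 : 0 < m by rewrite ltr0n.
(* These make [f] equal to [x * (tau p.q - |q|^2)] with [x = 1 / m]. Each tail coordinate then
   contributes [1 + 2 x - m x^2], since [tau^2 = m]; [x = 1 / m] maximises this, with value
   [1 + 1 / m]. *)
pose s (k : 'I_(r + p)) : R := if (k < r)%N then 0 else tau / m.
pose t (k : 'I_(r + p)) : R := if (k < r)%N then 0 else 2 / m.
pose f w : measurableTypeR R := \sum_k (s k * (X2 (z0, k) w * X2 (z1, k) w)
                                        - t k * X2 (z1, k) w ^+ 2 / 2).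
have mX2 := iX2.1.
have mf : measurable_fun setT f.
  apply: measurable_sum => k; apply: measurable_funB.
    by apply: measurable_funM => //; apply: measurable_funM; exact: mX2.
  apply: measurable_funM => //; apply: measurable_funM => //.
  by apply: measurable_funX; exact: mX2.
have lo (k : 'I_r) : (lshift p k < r)%N by rewrite /= ltn_ord.
have hi (k : 'I_p) : (rshift r k < r)%N = false by rewrite ltnNge /= leq_addr.
have fE w : f w = m^-1 * (tau * (\sum_k X2 (z0, rshift r k) w * X2 (z1, rshift r k) w)
                          - \sum_k X2 (z1, rshift r k) w ^+ 2).
  rewrite /f big_split_ord /= big1 ?add0r => [|k _]; last by rewrite /s /t lo; ring.
  rewrite mulrBr !mulr_sumr -sumrB; apply: eq_bigr => k _; rewrite /s /t hi.
  by field; rewrite gt_eqF.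
pose Mix (w : T) (ij : 'I_(2 + r) * 'I_(r + p)) := if (ij.1 < 2)%N then X ij w else X ij w'.
have sub : [set w | F (Mix w)] `<=` [set w | 0 <= f w].
  move=> w /= h; rewrite fE; apply: mulr_ge0; first by rewrite invr_ge0 ltW.
  rewrite subr_ge0.
  pose Z := sample_mx (Mix w); pose X' := Z *m U.
  have GE : X' *m X'^T = G (Mix w).
    by rewrite trmx_mul mulmxA -(mulmxA Z) UUt mulmx1.
  have dn0 : \det (G (Mix w)) != 0.
    by apply/eqP => d00; move: h; rewrite /F /= d00 mul0r ltxx.
  have uK : G (Mix w) \in unitmx by rewrite unitmxE unitfE.
  have X'E (i : 'I_(2 + r)) k : (i < 2)%N -> X' i k = X2 (i, k) w.
    by move=> i2; rewrite mxE; apply: eq_bigr => l _; rewrite mxE /Mix/= i2.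
  have := @negative_multiplier_tail R r p X' (invmx (G (Mix w)) *m b) tau.
  rewrite GE mulmxA mulmxV// mul1mx.
  under eq_bigr do rewrite X'E//.
  under [X in _ <= _ * X]eq_bigr do rewrite !X'E//.
  apply => //.
    move=> l k; have := low l (rshift r k); rewrite ltn_addr ?ltn_ord// => /(_ isT) <-.
    by rewrite !mxE; apply: eq_bigr => j _; rewrite !mxE /Mix/=.
  rewrite /invmx uK -scalemxAl mxE.
  have -> : (\det (G (Mix w)))^-1 * (\adj (G (Mix w)) *m b) z0 0 =
     (\det (G (Mix w)) ^+ 2)^-1 * (\det (G (Mix w)) * (\adj (G (Mix w)) *m b) z0 0) by field.
  by rewrite pmulr_rlt0// invr_gt0 exprn_even_gt0.
have mE : measurable [set w | F (Mix w)].
  apply: (measurable_event (X := fun ij w => Mix w ij)) => // ij.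
  by rewrite /Mix; case: (_ < 2)%N; [exact: iX.1|exact: measurable_cst].
have mE' : measurable [set w | (0 : R) <= f w].
  rewrite (_ : [set w | _] = f @^-1` `[0, +oo[%classic).
    by rewrite -[X in measurable X]setTI; exact: mf.
  by apply/seteqP; split => w /=; rewrite in_itv/= andbT.
apply: (@le_trans _ _ (P [set w | (0 : R) <= f w])).
  by apply: le_measure; rewrite ?inE.
apply: le_trans (markov_expR P mf) _.
have ts k : 1 + t k - s k ^+ 2 = if (k < r)%N then 1 else 1 + m^-1.
  rewrite /t /s; case: ifP => _; first by ring.
  by rewrite exprMn tau2 -/m; field; rewrite gt_eqF.
rewrite iidN_mgf//; last first.
  by move=> k; rewrite ts; case: ifP => // _; rewrite addr_gt0 ?invr_gt0.
rewrite lee_fin big_split_ord /= big1 ?mul1r => [|k _]; last first.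
  by rewrite ts lo sqrtr1 invr1.
under eq_bigr do rewrite ts hi.
rewrite prodr_const card_ord.
have -> : - (p%:R / (2 * r.+2%:R)) = p%:R * - (m^-1 / (2 * (1 + m^-1))) :> R.
  rewrite (_ : r.+2%:R = m + 1 :> R); last by rewrite -natr1.
  field; rewrite !gt_eqF// addr_gt0//.
rewrite expRM_natl; apply: lerXn2r; rewrite ?nnegrE ?invr_ge0 ?sqrtr_ge0 ?expR_ge0//.
by apply: invr_sqrt_le_expR; rewrite addr_gt0 ?invr_gt0.
Qed.

Lemma iidN_of_independent (R : realType) (d : measure_display) (T : measurableType d)
    (P : probability T R) (I : finType) (Z : I -> T -> R) :
  mutually_independent P Z -> (forall i, std_normal P (Z i)) -> iidN P Z.
Proof.
move=> [mZ PZ] nZ; split=> // B mB.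
rewrite (_ : [set w | _] = \bigcap_(i in [set: I]) (Z i @^-1` B i)); last first.
  by apply/seteqP; split => w /= h i; [move=> _; exact: h|exact: h].
by apply: (etrans (PZ B mB)); apply: eq_bigr => i _; exact: nZ (mB i).
Qed.

Lemma holds_with_prob_ge_le0 (R : realType) (d : measure_display) (T : measurableType d)
    (P : probability T R) (q : R) (Q : T -> Prop) : q <= 0 -> holds_with_prob_ge P q Q.
Proof.
by move=> q0; exists set0; split=> //; split=> //; rewrite measure0 lee_fin.
Qed.

Lemma holds_with_prob_ge_union (R : realType) (d : measure_display) (T : measurableType d)
    (P : probability T R) (I : finType) (B : I -> set T) (b : I -> R) (q : R)
    (Q : T -> Prop) :
  (forall i, measurable (B i)) -> (forall i, (P (B i) <= (b i)%:E)%E) ->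
  \sum_i b i <= q -> (forall w, (forall i, ~ B i w) -> Q w) ->
  holds_with_prob_ge P (1 - q) Q.
Proof.
move=> mB PB bq BQ; pose S (s : seq I) := \big[setU/set0]_(i <- s) B i.
have mS s : measurable (S s) by apply: bigsetU_measurable.
have PS s : (P (S s) <= (\sum_(i <- s) b i)%:E)%E.
  elim: s => [|i s IH]; first by rewrite /S !big_nil measure0.
  rewrite /S !big_cons EFinD; apply: le_trans (measureU2 _ _ _) _ => //; first exact: mS.
  by apply: leeD; [exact: PB|exact: IH].
exists (~` S (index_enum I)); split; first exact: measurableC.
split.
  rewrite probability_setC// EFinB; apply: leeB => //.
  by apply: le_trans (PS _) _; rewrite lee_fin.
move=> w nS; apply: BQ => i Bi; apply: nS.
by rewrite /S -bigcup_seq; exists i => //=; exact: mem_index_enum.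
Qed.

(** A left null vector [v] of the Gram matrix satisfies [|v Z|^2 = 0], hence is a left null vector
    of the leading square block too. *)
Lemma gram_unitmx (R : realType) (n d : nat) (nd : (n <= d)%N) (Z : 'M[R]_(n, d)) :
  \det (\matrix_(i < n, j < n) Z (widen_ord (leqnn n) i) (widen_ord nd j)) != 0 ->
  Z *m Z^T \in unitmx.
Proof.
apply: contraNT; rewrite unitmxE unitfE negbK => /det0P[v v0 vK].
apply/det0P; exists v => //.
have vZ : v *m Z = 0.
  apply/matrixP => a j; rewrite [a]ord1 [RHS]mxE.
  have : (v *m Z *m (v *m Z)^T) 0 0 = 0.
    by rewrite trmx_mul mulmxA -(mulmxA v) vK mul0mx mxE.
  rewrite mxE => /eqP; under eq_bigr do rewrite [(v *m Z)^T _ _]mxE -expr2.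
  rewrite psumr_eq0 => [/allP h|k _]; last exact: sqr_ge0.
  by have := h j (mem_index_enum _); rewrite /= sqrf_eq0 => /eqP.
apply/matrixP => a j; rewrite [RHS]mxE.
have := congr1 (fun M : 'rV[R]_d => M a (widen_ord nd j)) vZ; rewrite [RHS]mxE => <-.
rewrite !mxE; apply: eq_bigr => k _; rewrite mxE; congr (_ * Z _ _); exact: val_inj.
Qed.

Lemma prob_negative_multiplier (R : realType) (d0 : measure_display)
    (T : measurableType d0) (P : probability T R) (r p : nat)
    (X : 'I_(2 + r) * 'I_(r + p) -> T -> measurableTypeR R) (Y : 'cV[R]_(2 + r))
    (i : 'I_(2 + r)) :
  iidN P X -> pm1_vector Y ->
  exists B : set T, [/\ measurable B, (P B <= (expR (- (p%:R / (2 * r.+2%:R))))%:E)%E &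
    forall w, ~ B w ->
      let K := sample_mx (fun ij => X ij w) *m (sample_mx (fun ij => X ij w))^T in
      K \in unitmx -> 0 <= Y i 0 * (invmx K *m Y) i 0].
Proof.
move=> iX pmY.
have [U [tau [rU tau2] neg]] := negative_multiplier_rotation i pmY.
pose b : 'cV[R]_(2 + r) := \col_l (if l == lshift r 0 then 1 else
   if l == lshift r 1 then tau else 0).
pose X' (lk : 'I_(2 + r) * 'I_(r + p)) w : measurableTypeR R :=
  \sum_j X (j, lk.2) w * U j lk.1.
have iX' : iidN P X'.
  (* Rotations act on the second index; transposing the index pair makes them mix samples instead of
     coordinates. *)
  have i1 : iidN P (fun kj : 'I_(r + p) * 'I_(2 + r) => X (kj.2, kj.1)).
    by apply: (iidN_reindex (e := fun kj : 'I_(r + p) * 'I_(2 + r) => (kj.2, kj.1))) => //;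
      move=> [a c] [a' c'] [-> ->].
  have i2 := iidN_rotation rU i1.
  apply: (iidN_reindex (e := fun lk : 'I_(2 + r) * 'I_(r + p) => (lk.2, lk.1)) _ i2).
  by move=> [a c] [a' c'] [-> ->].
have X'E w : sample_mx (fun ij => X' ij w) = U^T *m sample_mx (fun ij => X ij w).
  by apply/matrixP => l k; rewrite !mxE; apply: eq_bigr => j _; rewrite !mxE mulrC.
pose G (x : sample R ('I_(2 + r) * 'I_(r + p))%type) := sample_mx x *m (sample_mx x)^T.
pose F : set (sample R ('I_(2 + r) * 'I_(r + p))%type) :=
  [set x | (\det (G x) * (\adj (G x) *m b) (lshift r 0) 0 < 0)%R].
have mG i j := @measurable_gram R (2 + r) (r + p) i j.
have mF : measurable F.
  rewrite (_ : F = (fun x => \det (G x) * (\adj (G x) *m b) (lshift r 0) 0 : measurableTypeR R)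
    @^-1` `]-oo, 0[%classic); last by apply/seteqP; split => x /=; rewrite in_itv.
  rewrite -[X in measurable X]setTI.
  apply: (_ : measurable_fun setT (fun x => \det (G x) * (\adj (G x) *m b) (lshift r 0) 0
    : measurableTypeR R)) => //.
  by apply: measurable_funM; [exact: measurable_det|exact: measurable_adjugate_mul].
exists [set w | F (fun ij => X' ij w)]; split.
- exact: measurable_event iX'.1 mF.
- exact: prob_negative_multiplier_tail iX' tau2.
move=> w nF K uK; rewrite leNgt; apply/negP => neg'; apply: nF.
have [uK' lt0] := neg _ _ uK neg'.
rewrite /F /= /G X'E; set K' := _ *m _^T in uK' lt0 *.
have dn0 : \det K' != 0 by rewrite -unitfE -unitmxE.
move: lt0; rewrite {1}/invmx uK' -scalemxAl mxE -/b.
have -> : \det K' * (\adj K' *m b) (lshift r 0) 0 =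
  \det K' ^+ 2 * ((\det K')^-1 * (\adj K' *m b) (lshift r 0) 0) by field.
by move=> h; rewrite pmulr_rlt0 ?exprn_even_gt0.
Qed.

Lemma expR_Nln_le (R : realType) (n k : nat) (x : R) : (0 < n)%N ->
  k%:R * ln (n%:R : R) <= x -> expR (- x) <= n%:R^-1 ^+ k.
Proof.
move=> n0 h.
have nR : (n%:R : R) \is Num.pos by rewrite posrE ltr0n.
apply: (@le_trans _ _ (expR (- (k%:R * ln (n%:R : R))))); first by rewrite ler_expR lerN2.
by rewrite -mulrN expRM_natl expRN lnK.
Qed.

Lemma identity_gram_interpolates (R : realType) (d0 : measure_display)
    (T : measurableType d0) (P : probability T R) (r p : nat)
    (Z : 'I_(2 + r) * 'I_(r + p) -> T -> measurableTypeR R)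
    (Phi : T -> 'M[R]_(2 + r, r + p)) (Y : 'cV[R]_(2 + r)) :
  (2 <= p)%N -> iidN P Z -> pm1_vector Y ->
  (forall w, Phi w *m (Phi w)^T =
     sample_mx (fun ij => Z ij w) *m (sample_mx (fun ij => Z ij w))^T) ->
  10 * r.+2%:R * ln (r.+2%:R : R) <= p%:R ->
  holds_with_prob_ge P (1 - 2 / r.+2%:R) (fun w => svm_interpolates (Phi w) Y).
Proof.
move=> p2 iZ pmY gram hp.
have nd : (2 + r <= r + p)%N by rewrite addnC leq_add2l.
have n0 : (0 : R) < r.+2%:R by rewrite ltr0n.
have L0 : 0 <= ln (r.+2%:R : R) by rewrite ln_ge0// ler1n.
pose D w := \det (\matrix_(i < 2 + r, j < 2 + r)
  Z (widen_ord (leqnn (2 + r)) i, widen_ord nd j) w).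
have [B hB] := choice (fun i => @prob_negative_multiplier R d0 T P r p Z Y i iZ pmY).
(* [None] is the null event on which the Gram matrix may be singular. For [Some i] the exponent
   [p / (2 n)] is at least [2 ln n], whence [n^-2]; the sum over [i] is [1 / n]. *)
pose BO (o : option 'I_(2 + r)) := if o is Some i then B i else [set w | D w = 0].
pose bO (o : option 'I_(2 + r)) : R :=
  if o is Some i then r.+2%:R^-1 ^+ 2 else 0.
apply: (@holds_with_prob_ge_union _ _ _ _ _ BO bO).
- case=> [i|] /=; first by case: (hB i).
  have mD : measurable_fun setT (D : T -> measurableTypeR R).
    apply: measurable_det => i j.
    apply: (eq_measurable_fun (Z (widen_ord (leqnn (2 + r)) i, widen_ord nd j))).
      by move=> w _; rewrite mxE.
    exact: iZ.1.
  by have := mD measurableT [set 0] (measurable_set1 _); rewrite setTI.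
- case=> [i|] /=; last by rewrite (iidN_minor (leqnn (2 + r)) nd iZ).
  case: (hB i) => _ h _; apply: le_trans h _; rewrite lee_fin.
  apply: expR_Nln_le => //; rewrite ler_pdivlMr ?mulr_gt0//.
  apply: le_trans hp; rewrite -subr_ge0.
  have -> : 10 * r.+2%:R * ln (r.+2%:R : R) - 2 * ln (r.+2%:R : R) * (2 * r.+2%:R) =
    6 * r.+2%:R * ln (r.+2%:R : R) by ring.
  by rewrite !mulr_ge0.
- rewrite (bigD1 None)//= add0r (eq_bigr (fun=> r.+2%:R^-1 ^+ 2)); last by case.
  rewrite sumr_const (_ : #|_| = r.+2); last first.
    by apply: (etrans (cardC1 None)); rewrite card_option card_ord.
  rewrite -[leLHS]mulr_natl.
  rewrite expr2 mulrA divff ?gt_eqF// mul1r ler_peMl ?invr_ge0 ?ler0n//.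
  by rewrite ler1n.
move=> w nB.
have uK : sample_mx (fun ij => Z ij w) *m (sample_mx (fun ij => Z ij w))^T \in unitmx.
  apply: (@gram_unitmx _ _ _ nd); apply/eqP => h; apply: (nB None); rewrite /= /D -[RHS]h.
  by congr (\det _); apply/matrixP => i j; rewrite !mxE.
apply: (svm_interpolates_dual (c := invmx (sample_mx (fun ij => Z ij w) *m
   (sample_mx (fun ij => Z ij w))^T) *m Y)) => //.
  by rewrite gram mulKVmx.
by move=> i; case: (hB i) => _ _; apply => //; exact: (nB (Some i)).
Qed.

(** * Part 1: diagonalising the covariance and dominance of the Gram diagonal *)

(** Induction on the rows: each earlier row [j] is plus or minus a basis vector, so orthogonality to
    it kills the entry in column [j]. *)
Lemma lower_orthogonal_diag (R : realType) (d : nat) (M : 'M[R]_d) :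
  M *m M^T = 1%:M -> (forall i j : 'I_d, (i < j)%N -> M i j = 0) ->
  (forall i j, i != j -> M i j = 0) /\ (forall i, M i i ^+ 2 = 1).
Proof.
move=> MM low.
have dotE i j : \sum_k M i k * M j k = (i == j)%:R.
  have := congr1 (fun N : 'M[R]_d => N i j) MM; rewrite !mxE => <-.
  by apply: eq_bigr => k _; rewrite mxE.
have sq i : (forall j, i != j -> M i j = 0) -> M i i ^+ 2 = 1.
  move=> off; have := dotE i i; rewrite eqxx (bigD1 i)//= big1 ?addr0 ?expr2// => k ki.
  by rewrite off ?mul0r// eq_sym.
suff off n : forall i : 'I_d, (i < n)%N -> forall j, i != j -> M i j = 0.
  by split=> [i j ij|i]; [exact: (off d)|apply: sq; exact: (off d)].
elim: n => [//|n IH] i; rewrite ltnS => iln j ij.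
have [ltij|] := ltnP i j; first exact: low.
rewrite leq_eqVlt => /orP[/eqP e|ji]; first by move: ij; rewrite (val_inj e : j = i) eqxx.
have offj := IH j (leq_trans ji iln).
have := dotE i j; rewrite (negbTE ij) (bigD1 j)//= big1 ?addr0 => [/eqP|k kj]; last first.
  by rewrite offj ?mulr0// eq_sym.
rewrite mulf_eq0 => /orP[/eqP//|/eqP Mjj].
by have := sq _ offj; rewrite Mjj expr0n => /eqP; rewrite eq_sym oner_eq0.
Qed.

(** [W = A U^T diag(lam)^(-1/2)] is orthogonal and diagonalises [A A^T], but its determinant may be
    -1, which no product of Givens rotations has. Triangularising [W^T] leaves a diagonal matrix of
    signs, and these cancel around [diag_mx lam]. *)
Lemma covariance_rotation (R : realType) (d : nat) (A U : 'M[R]_d) (lam : 'rV[R]_d) :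
  (forall j, 0 < lam 0 j) -> U^T *m U = 1%:M ->
  A^T *m A = U^T *m diag_mx lam *m U ->
  exists2 Q : 'M[R]_d, rotation Q & A *m A^T = Q *m diag_mx lam *m Q^T.
Proof.
move=> lam0 UtU AtA; have UUt := mulmx1C UtU.
pose h : 'M[R]_d := diag_mx (\row_j (Num.sqrt (lam 0 j))^-1).
have hT : h^T = h by rewrite tr_diag_mx.
have hlh : h *m diag_mx lam *m h = 1%:M.
  apply/matrixP => i j; rewrite mul_mx_diag mul_diag_mx !mxE.
  have [->|ij] := eqVneq i j; last by rewrite mulr0n mulr0 mul0r.
  by rewrite !mulr1n mulrAC -invfM -expr2 sqr_sqrtr ?(ltW (lam0 j))// mulVf// gt_eqF.
pose W := A *m U^T *m h.
have WtW : W^T *m W = 1%:M.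
  rewrite /W !trmx_mul trmxK hT !mulmxA -(mulmxA (h *m U)) AtA !mulmxA.
  by rewrite -(mulmxA h U U^T) UUt mulmx1 -(mulmxA _ U U^T) UUt mulmx1.
have WlW : W *m diag_mx lam *m W^T = A *m A^T.
  rewrite /W !trmx_mul trmxK hT !mulmxA.
  rewrite -(mulmxA _ h (diag_mx lam)) -(mulmxA _ (h *m diag_mx lam) h) hlh mulmx1.
  by rewrite -(mulmxA A) UtU mulmx1.
clearbody W; have [Q rQ low] := rotation_lower W^T.
have QtQ := rotation_orthogonal rQ; have QQt := mulmx1C QtQ.
pose M := W^T *m Q.
have MM : M *m M^T = 1%:M.
  by rewrite /M trmx_mul trmxK mulmxA -(mulmxA W^T) QQt mulmx1.
have [off sq] := lower_orthogonal_diag MM low.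
have WE : W = Q *m M^T.
  by rewrite /M trmx_mul trmxK mulmxA QQt mul1mx.
clearbody M.
have MlM : M^T *m diag_mx lam *m M = diag_mx lam.
  apply/matrixP => i j; rewrite mxE (bigD1 i)//= big1 ?addr0 => [|k ki]; last first.
    by rewrite mul_mx_diag 2!mxE off ?mul0r.
  rewrite mul_mx_diag 2!mxE [RHS]mxE.
  have [->|ij] := eqVneq i j; last by rewrite (off i j)// mulr0 mulr0n.
  by rewrite mulr1n mulrAC -expr2 sq mul1r.
exists Q => //; rewrite -WlW -[in RHS]MlM.
by rewrite WE (trmx_mul Q M^T) trmxK !mulmxA.
Qed.

Lemma gram_entry (R : realType) (n d : nat) (X : 'M[R]_(n, d)) (lam : 'rV[R]_d) i j :
  (X *m diag_mx lam *m X^T) i j = \sum_k lam 0 k * (X i k * X j k).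
Proof.
rewrite mxE; apply: eq_bigr => k _; rewrite mul_mx_diag !mxE; ring.
Qed.

(** With [y = s^2 lam^2 <= 1/4] the exponent [y / (2 (1 - y))] is at most [2/3 y]. The weights may
    have any sign, so the lower tail is the upper tail for [- lam]. *)
Lemma prob_offdiag_gram (R : realType) (d0 : measure_display) (T : measurableType d0)
    (P : probability T R) (J K : finType) (X : J * K -> T -> measurableTypeR R)
    (lam : K -> R) (p q : J) (s x : R) :
  p != q -> iidN P X -> (forall k, s ^+ 2 * lam k ^+ 2 <= 1 / 4) -> 0 < s ->
  (P [set w | (x <= \sum_k lam k * (X (p, k) w * X (q, k) w))%R] <=
   (expR (- (s * x) + 2 / 3 * (s ^+ 2 * \sum_k lam k ^+ 2)))%:E)%E.
Proof.
move=> pq iX slam s0; have mX := iX.1.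
pose f w : measurableTypeR R :=
  s * (\sum_k lam k * (X (p, k) w * X (q, k) w)) - s * x.
have mf : measurable_fun setT f.
  apply: measurable_funB => //; apply: measurable_funM => //.
  apply: measurable_sum => k; apply: measurable_funM => //.
  by apply: measurable_funM; exact: mX.
rewrite (_ : [set w | _] = [set w | (0 <= f w)%R]); last first.
  by apply/seteqP; split => w /=; rewrite /f subr_ge0 ler_pM2l.
apply: le_trans (markov_expR P mf) _.
pose g (w : T) : R := \sum_k (s * lam k * (X (p, k) w * X (q, k) w)
                              - 0 * X (q, k) w ^+ 2 / 2).
have sl1 k : 0 < 1 + 0 - (s * lam k) ^+ 2.
  by rewrite addr0 exprMn subr_gt0; apply: le_lt_trans (slam k) _; lra.
have mg : measurable_fun setT (fun w => (expR (g w))%:E).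
  apply/measurable_EFinP; apply: measurableT_comp => //.
  apply: measurable_sum => k; apply: measurable_funB.
    by apply: measurable_funM => //; apply: measurable_funM; exact: mX.
  apply: measurable_funM => //; apply: measurable_funM => //.
  by apply: measurable_funX; exact: mX.
have -> : (\int[P]_w (expR (f w))%:E =
    (expR (- (s * x)))%:E * \int[P]_w (expR (g w))%:E)%E.
  rewrite -ge0_integralZl//.
  apply: eq_integral => w _; rewrite -EFinM -expRD; congr (expR _)%:E.
  rewrite /f /g addrC mulr_sumr; congr (_ + _); apply: eq_bigr => k _; ring.
rewrite (iidN_mgf (s := fun k => s * lam k) (t := fun=> 0) pq iX sl1) -EFinM lee_fin.
rewrite expRD ler_wpM2l ?expR_ge0// mulr_sumr mulr_sumr expR_sum.
apply: ler_prod => k _; rewrite invr_ge0 sqrtr_ge0/=.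
have e : 1 + 0 - (s * lam k) ^+ 2 = 1 + - (s ^+ 2 * lam k ^+ 2) by rewrite exprMn addr0.
have y0 : 0 < 1 + - (s ^+ 2 * lam k ^+ 2) by rewrite -e.
rewrite e; apply: le_trans (invr_sqrt_le_expR y0) _; rewrite ler_expR.
have := slam k; have : 0 <= s ^+ 2 * lam k ^+ 2 by rewrite mulr_ge0 ?sqr_ge0.
move: y0; set y := s ^+ 2 * lam k ^+ 2 => y1 y00 y4.
rewrite mulNr opprK ler_pdivrMr; last by rewrite mulr_gt0.
nra.
Qed.

(** Here [y = s lam <= 1/4] gives [y / (1 + 2 y) >= 2/3 y]. As [2/3 > 1/2], the bound decays
    exponentially at [x] equal to half the mean. *)
Lemma prob_diag_gram (R : realType) (d0 : measure_display) (T : measurableType d0)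
    (P : probability T R) (J K : finType) (X : J * K -> T -> measurableTypeR R)
    (lam : K -> R) (p : J) (s x : R) :
  iidN P X -> (forall k, 0 <= lam k) -> (forall k, s * lam k <= 1 / 4) -> 0 < s ->
  (P [set w | (\sum_k lam k * (X (p, k) w * X (p, k) w) <= x)%R] <=
   (expR (s * x - 2 / 3 * (s * \sum_k lam k)))%:E)%E.
Proof.
move=> iX lam0 slam s0; have mX := iX.1.
pose f w : measurableTypeR R :=
  s * x - s * (\sum_k lam k * (X (p, k) w * X (p, k) w)).
have mf : measurable_fun setT f.
  apply: measurable_funB => //; apply: measurable_funM => //.
  apply: measurable_sum => k; apply: measurable_funM => //.
  by apply: measurable_funM; exact: mX.
rewrite (_ : [set w | _] = [set w | (0 <= f w)%R]); last first.
  by apply/seteqP; split => w /=; rewrite /f subr_ge0 ler_pM2l.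
apply: le_trans (markov_expR P mf) _.
pose g k (u : measurableTypeR R) : \bar R :=
  (expR (0 * u - 2 * s * lam k * u ^+ 2 / 2))%:E.
have mg k : measurable_fun setT (g k).
  apply/measurable_EFinP; apply: measurableT_comp => //.
  apply: measurable_funB; first exact: measurable_funM.
  by apply: measurable_funM => //; apply: measurable_funM.
have g0 k u : (0 <= g k u)%E by rewrite lee_fin expR_ge0.
have iXp : iidN P (fun k => X (p, k)).
  by apply: (iidN_reindex (e := fun k => (p, k))) => // j k [].
have mprod : measurable_fun setT (fun w => \prod_k g k (X (p, k) w))%E.
  apply: (measurableT_comp (measurable_eprod_coord (index_enum K) mg)).
  exact: measurable_sample iXp.1.
have -> : (\int[P]_w (expR (f w))%:E =
    (expR (s * x))%:E * \int[P]_w \prod_k g k (X (p, k) w))%E.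
  rewrite -ge0_integralZl//; last first.
    by move=> w _; elim/big_ind: _ => // a b; exact: mule_ge0.
  apply: eq_integral => w _; rewrite prodEFin -expR_sum -EFinM -expRD; congr (expR _)%:E.
  rewrite /f mulr_sumr -sumrN; congr (_ + _).
  by apply: eq_bigr => k _; field.
have /= -> := iidN_integral_prod iXp mg g0.
have sl0 k : 0 <= s * lam k by rewrite mulr_ge0// ltW.
have t0 k : 0 < 1 + 2 * s * lam k by rewrite -mulrA; have := sl0 k; lra.
under eq_bigr do rewrite /g integral_expR_normal_prob// expr0n mul0r expR0 mul1r.
rewrite prodEFin -EFinM lee_fin expRD ler_wpM2l ?expR_ge0//.
rewrite mulr_sumr mulr_sumr -sumrN expR_sum.
apply: ler_prod => k _; rewrite invr_ge0 sqrtr_ge0/=.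
apply: le_trans (invr_sqrt_le_expR (t0 k)) _; rewrite ler_expR lerN2.
have := t0 k; have := slam k; have := sl0 k.
rewrite -[2 * s * lam k]mulrA; set y := s * lam k => y0 y4 y1.
rewrite ler_pdivlMr; last by rewrite mulr_gt0.
nra.
Qed.

Lemma measurable_diag_form (R : realType) (d : measure_display) (T : measurableType d)
    (J K : finType) (X : J * K -> T -> measurableTypeR R) (lam : K -> R) (p q : J) (x : R) :
  (forall i, measurable_fun setT (X i)) ->
  measurable [set w | x <= \sum_k lam k * (X (p, k) w * X (q, k) w)] /\
  measurable [set w | \sum_k lam k * (X (p, k) w * X (q, k) w) <= x].
Proof.
move=> mX; pose f w : measurableTypeR R := \sum_k lam k * (X (p, k) w * X (q, k) w).
have mf : measurable_fun setT f.
  apply: measurable_sum => k; apply: measurable_funM => //.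
  by apply: measurable_funM; exact: mX.
split.
  rewrite (_ : [set w | _] = f @^-1` `[x, +oo[%classic).
    by rewrite -[X in measurable X]setTI; exact: mf.
  by apply/seteqP; split => w /=; rewrite in_itv/= andbT.
rewrite (_ : [set w | _] = f @^-1` `]-oo, x]%classic).
  by rewrite -[X in measurable X]setTI; exact: mf.
by apply/seteqP; split => w /=; rewrite in_itv.
Qed.

Lemma diagonal_gram_interpolates (R : realType) (d0 : measure_display)
    (T : measurableType d0) (P : probability T R) (n d : nat)
    (X : 'I_n * 'I_d -> T -> measurableTypeR R) (lam : 'rV[R]_d)
    (Phi : T -> 'M[R]_(n, d)) :
  (2 <= n)%N -> (n <= d)%N -> iidN P X -> (forall j, 0 < lam 0 j) ->
  (forall w i j, (Phi w *m (Phi w)^T) i j = \sum_k lam 0 k * (X (i, k) w * X (j, k) w)) ->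
  72 * (norm2 lam * n%:R * Num.sqrt (ln n%:R)
         + norminf lam * n%:R * Num.sqrt n%:R * ln n%:R + 1) <= norm1 lam ->
  holds_with_prob_ge P (1 - 2 / n%:R)
    (fun w => forall Y : 'cV[R]_n, pm1_vector Y -> svm_interpolates (Phi w) Y).
Proof.
move=> n2 nd iX lam0 gram.
have n0 : (0 < n)%N by exact: leq_trans n2.
set N : R := n%:R; have N2 : 2 <= N by rewrite ler_nat.
have N0 : 0 < N by lra.
set L := ln N; have L0 : 0 < L by apply: ln_gt0; lra.
set q := Num.sqrt L; have q0 : 0 < q by rewrite sqrtr_gt0.
have q2 : q * q = L by rewrite -expr2 sqr_sqrtr// ltW.
set rN := Num.sqrt N; have rN1 : 1 <= rN by rewrite -sqrtr1 ler_sqrt//; lra.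
set l1 := norm1 lam; set l2 := norm2 lam; set linf := norminf lam => H.
have l1E : \sum_k lam 0 k = l1 by apply: eq_bigr => k _; rewrite ger0_norm// ltW.
have l2E : \sum_k lam 0 k ^+ 2 = l2 ^+ 2.
  by rewrite sqr_sqrtr// sumr_ge0// => k _; exact: sqr_ge0.
have l20 : 0 <= l2 by exact: sqrtr_ge0.
have linfP k : lam 0 k <= linf.
  by apply: le_trans (ler_norm _) _; exact: (le_bigmax 0 (fun k => `|lam 0 k|)).
have linf0 : 0 < linf by apply: lt_le_trans (lam0 (Ordinal (leq_trans n0 nd))) (linfP _).
have infL : 0 < linf * L by rewrite mulr_gt0.
have infrL : linf * L <= linf * rN * L by rewrite ler_wpM2r ?ler_peMr// ltW.
(* The Chernoff parameter [so = q / D] lies below both the Gaussian choice [q / l2] and the cap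
   [1 / (2 linf)] that keeps the generating function finite. [tau] is the off-diagonal threshold,
   [sd] the parameter for the diagonal. *)
pose D := 2 * linf * q + l2.
have D0 : 0 < D by rewrite /D ltr_pwDl// !mulr_gt0.
pose so := q / D; pose tau := l1 / (4 * N); pose sd := (4 * linf)^-1.
have so0 : 0 < so by rewrite divr_gt0.
have sd0 : 0 < sd by rewrite invr_gt0 mulr_gt0.
have so_lam k : so * lam 0 k <= 1 / 2.
  rewrite /so mulrAC ler_pdivrMr// /D; have := linfP k; have := lam0 k.
  move=> a b; have : q * lam 0 k <= q * linf by rewrite ler_pM2l.
  lra.
have so_lam2 k : so ^+ 2 * lam 0 k ^+ 2 <= 1 / 4.
  rewrite -exprMn; have : 0 <= so * lam 0 k by rewrite mulr_ge0// ltW.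
  have := so_lam k; set z := so * lam 0 k; nra.
have sd_lam k : sd * lam 0 k <= 1 / 4.
  rewrite /sd mulrC ler_pdivrMr ?mulr_gt0//; have := linfP k; lra.
have so_l2 : so ^+ 2 * l2 ^+ 2 <= L.
  have so_l20 : 0 <= so * l2 by rewrite mulr_ge0// ltW.
  rewrite -exprMn -q2 -expr2 ler_pXn2r ?nnegrE ?(ltW q0)//.
  rewrite /so mulrAC ler_pdivrMr// ler_pM2l// /D lerDr.
  by rewrite !mulr_ge0// ltW.
(* Here [72 = 4 * 18] is spent: 4 is the denominator in [tau], and [18 (l2 q + linf rN L)] dominates
   [9 q D = 18 linf L + 9 l2 q]. The exponent is then at least [9 L - 2/3 L], enough for [n^-3]. *)
have so_tau : 9 * L <= so * tau.
  have tauD : 9 * (q * D) <= tau.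
    rewrite /tau ler_pdivlMr; last by rewrite mulr_gt0.
    apply: le_trans _ H.
    have -> : 72 * (l2 * N * q + linf * N * rN * L + 1) =
      (18 * (l2 * q + linf * rN * L)) * (4 * N) + 72 by ring.
    have : 9 * (q * D) <= 18 * (l2 * q + linf * rN * L).
      have -> : 9 * (q * D) = 18 * (linf * L) + 9 * (l2 * q) by rewrite /D -q2; ring.
      have : 0 <= l2 * q by rewrite mulr_ge0// ltW.
      lra.
    move=> h; have : 9 * (q * D) * (4 * N) <= 18 * (l2 * q + linf * rN * L) * (4 * N).
      by rewrite ler_pM2r// mulr_gt0.
    lra.
  have -> : 9 * L = so * (9 * (q * D)) by rewrite /so -q2; field; rewrite gt_eqF.
  by rewrite ler_pM2l.
have sd_l1 : 18 * L <= sd * l1.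
  rewrite /sd [leRHS]mulrC ler_pdivlMr ?mulr_gt0//.
  apply: le_trans _ H.
  have : linf * rN * L <= linf * N * rN * L.
    have -> : linf * N * rN * L = N * (linf * rN * L) by ring.
    by rewrite ler_peMl//; lra.
  have : 0 <= l2 * N * q by rewrite !mulr_ge0// ltW.
  move=> *; lra.
(* The flag selects the tail of an off-diagonal entry; diagonal events simply occur twice. In all
   [2 n^2] events at [n^-3] each, which sum to exactly [2 / n]. *)
pose B (ijb : 'I_n * 'I_n * bool) : set T :=
  if ijb.1.1 == ijb.1.2 then
    [set w | \sum_k lam 0 k * (X (ijb.1.1, k) w * X (ijb.1.1, k) w) <= l1 / 2]
  else if ijb.2 then [set w | tau <= \sum_k lam 0 k * (X (ijb.1.1, k) w * X (ijb.1.2, k) w)]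
  else [set w | tau <= \sum_k - lam 0 k * (X (ijb.1.1, k) w * X (ijb.1.2, k) w)].
apply: (@holds_with_prob_ge_union _ _ _ _ _ B (fun=> N^-1 ^+ 3)).
- move=> [[i j] b]; rewrite /B /=; case: (i == j).
    exact: (measurable_diag_form _ _ _ _ iX.1).2.
  by case: b; [exact: (measurable_diag_form (fun k => lam 0 k) _ _ _ iX.1).1
              |exact: (measurable_diag_form (fun k => - lam 0 k) _ _ _ iX.1).1].
- move=> [[i j] b]; rewrite /B /=; case: eqVneq => [_|ij].
    apply: (le_trans (prob_diag_gram (lam := fun k => lam 0 k) i (l1 / 2) iX
      (fun k => ltW (lam0 k)) sd_lam sd0)).
    rewrite lee_fin l1E -[_ - _]opprK; apply: expR_Nln_le => //; rewrite -/N -/L.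
    have -> : - (sd * (l1 / 2) - 2 / 3 * (sd * l1)) = sd * l1 / 6 by field.
    lra.
  have off : expR (- (so * tau) + 2 / 3 * (so ^+ 2 * l2 ^+ 2)) <= N^-1 ^+ 3.
    rewrite -[X in expR X]opprK; apply: expR_Nln_le => //; rewrite -/N -/L.
    lra.
  case: b.
    apply: (le_trans (prob_offdiag_gram (lam := fun k => lam 0 k) tau ij iX so_lam2 so0)).
    by rewrite lee_fin l2E.
  apply: (le_trans (prob_offdiag_gram (lam := fun k => - lam 0 k) tau ij iX _ so0)).
    by move=> k; rewrite sqrrN.
  by rewrite lee_fin; under eq_bigr do rewrite sqrrN; rewrite l2E.
- rewrite sumr_const !card_prod card_ord card_bool -[leLHS]mulr_natl !natrM -/N.
  rewrite le_eqVlt; apply/orP; left; apply/eqP; field; rewrite gt_eqF//.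
move=> w good Y pmY.
have l10 : 0 < l1.
  by rewrite -(pmulr_rgt0 _ sd0); apply: lt_le_trans sd_l1; rewrite mulr_gt0.
have [|||c Kc Yc] := @diag_dominant_sign _ _ (Phi w *m (Phi w)^T) (l1 / 2) Y _ _ _ pmY.
- by rewrite divr_gt0.
- move=> i; rewrite gram; have := good (i, i, true); rewrite /B /= eqxx => /negP.
  by rewrite -ltNge => /ltW.
- move=> i j ij; rewrite gram.
  have -> : l1 / 2 / (2 * N) = tau by rewrite /tau; field; rewrite gt_eqF.
  have := good (i, j, true); have := good (i, j, false).
  rewrite /B /= (negbTE ij) => /negP; rewrite -ltNge => h1 /negP; rewrite -ltNge => h2.
  rewrite ler_norml (ltW h2) andbT lerNl -sumrN; apply/ltW.
  by under eq_bigr do rewrite -mulNr.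
exact: svm_interpolates_dual Kc Yc.
Qed.

Theorem theorem1 (R : realType) (d0 : measure_display) (T : measurableType d0)
  (P : probability T R) (n d : nat) (Sigma : 'M[R]_d) (lam : 'rV[R]_d)
  (Phi : T -> 'M[R]_(n, d)) :
  (1 <= n)%N -> (n <= d)%N ->
  positive_definite Sigma ->
  eigenvalue_vector Sigma lam ->
  (forall j, 0 < lam 0 j) ->
  iid_gaussian_rows P Sigma Phi ->
  (72 * (norm2 lam * n%:R * Num.sqrt (ln n%:R)
         + norminf lam * n%:R * Num.sqrt n%:R * ln n%:R + 1) <= norm1 lam ->
   holds_with_prob_ge P (1 - 2 / n%:R)
     (fun w => forall Y : 'cV[R]_n, pm1_vector Y -> svm_interpolates (Phi w) Y))
  /\
  (Sigma = 1%:M -> 10 * n%:R * ln n%:R + n%:R - 1 < (d%:R : R) ->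
   forall Y : 'cV[R]_n, pm1_vector Y ->
   holds_with_prob_ge P (1 - 2 / n%:R) (fun w => svm_interpolates (Phi w) Y)).
Proof.
move=> n1 nd _ [[U [UtU SE]] _] lam0 [Z [A [indZ [nZ [AtA PhiE]]]]].
have iZ := iidN_of_independent indZ nZ.
(* For [n = 1] the claimed probability is [1 - 2 < 0], and the empty event is a witness. *)
have [n2|n2] := ltnP n 2.
  have n11 : n = 1%N by apply/eqP; rewrite eqn_leq n1 -ltnS n2.
  have q0 : 1 - 2 / n%:R <= 0 :> R by rewrite n11 divr1; lra.
  by split=> *; exact: holds_with_prob_ge_le0.
have gram w : Phi w *m (Phi w)^T =
    sample_mx (fun ij => Z ij w) *m (A *m A^T) *m (sample_mx (fun ij => Z ij w))^T.
  by rewrite PhiE trmx_mul !mulmxA.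
split=> [H|S1 dn Y pmY].
  have [Q rQ AAt] := covariance_rotation lam0 UtU (etrans AtA SE).
  apply: diagonal_gram_interpolates n2 nd (iidN_rotation rQ iZ) lam0 _ H => w i j.
  rewrite gram AAt !mulmxA -(mulmxA _ Q^T) -trmx_mul gram_entry.
  by apply: eq_bigr => k _; congr (_ * (_ * _)); rewrite mxE;
    apply: eq_bigr => l _; rewrite mxE.
have gram1 w : Phi w *m (Phi w)^T =
    sample_mx (fun ij => Z ij w) *m (sample_mx (fun ij => Z ij w))^T.
  by rewrite gram mulmx1C ?mulmx1// AtA.
(* Now [p = d - n + 2] is the dimension of the tails. The assumption on [d] reads
   [p > 10 n ln n + 1], which also yields [2 <= p]. *)
have [r nE] : exists r, n = (2 + r)%N by exists (n - 2)%N; rewrite subnKC.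
have [p dE] : exists p, d = (r + p)%N.
  by exists (d - r)%N; rewrite subnKC// (leq_trans _ nd)// nE leq_addl.
clear -iZ gram1 nd dn pmY nE dE; subst n d.
have L0 : 0 <= ln (r.+2%:R : R) by rewrite ln_ge0// ler1n.
have hp : 10 * r.+2%:R * ln (r.+2%:R : R) + 1 < p%:R.
  move: dn; rewrite [(r + p)%:R]natrD -[(2 + r)%N]/(r.+2).
  have -> : r.+2%:R = r%:R + 2 :> R by rewrite -addn2 natrD.
  set K := 10 * _ * _; lra.
have nL : 0 <= 10 * r.+2%:R * ln (r.+2%:R : R) by rewrite !mulr_ge0.
apply: identity_gram_interpolates iZ pmY gram1 _ => //.
  by rewrite -(ltr_nat R); lra.
by lra.
Qed.
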